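(* Let $P=\{p_1,\dots,p_n\}\subset\mathbb{R}^d$, let $\epsilon,\delta>0$, and let $\rho>0$ be such that $\max_{x\in\mathbb{R}^d} G_P(x)\ge \rho n$, where $G_P(x)=\sum_{p\in P} e^{-\|p-x\|^2}$. Consider the following procedure: set $\gamma=\frac{\epsilon}{4\log(4/\epsilon\rho)}$; choose a random matrix $\Pi\in\mathbb{R}^{m\times d}$ satisfying the $(\gamma,n+1,\delta)$-Johnson–Lindenstrauss guarantee; compute $\Pi P=\{\Pi p_1,\dots,\Pi p_n\}$; using any algorithm for mode finding in $\mathbb{R}^m$, find $x''\in\mathbb{R}^m$ with $G_{\Pi P}(x'')\ge(1-\epsilon/2)\max_{x\in\mathbb{R}^m} G_{\Pi P}(x)$; and return the single mean-shift step $x'=\frac{\sum_{p\in P} p\, e^{-\|x''-\Pi p\|^2}}{\sum_{p\in P} e^{-\|x''-\Pi p\|^2}}$. Then, with probability $1-\delta$, the returned $x'$ satisfies $G_P(x')\ge(1-\epsilon)\max_{x} G_P(x)$. When implemented with a random Rademacher or Gaussian $\Pi$, the procedure runs in time $O(ndm)+T_{m,(1-\epsilon/2)}$, where $m=O\!\left(\frac{\log(n/\delta)\log^2(1/\epsilon\rho)}{\epsilon^2}\right)$ and $T_{m,(1-\epsilon/2)}$ is the time required to compute a $(1-\epsilon/2)$-approximate mode for an $O(m)$-dimensional dataset.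
   Context: A randomly selected matrix $\Pi\in\mathbb{R}^{m\times d}$ satisfies the $(\gamma,k,\delta)$-Johnson–Lindenstrauss guarantee if for any $k$ points $v_1,\dots,v_k\in\mathbb{R}^d$, with probability $1-\delta$, simultaneously for all pairs $i,j$: $\|v_i-v_j\|\le\|\Pi v_i-\Pi v_j\|\le(1+\gamma)\|v_i-v_j\|$. A properly scaled random Gaussian or sign matrix satisfies this when $m=O(\log(k/\delta)/\gamma^2)$, and can be multiplied by a $d$-dimensional vector in $O(md)$ time.
   Formalization: The bound on m is proved with a constant depending on κ, for ε ≤ κ and log(n/δ), log(1/ερ) ≥ 1/κ (any κ > 0), since it fails when a logarithm tends to 0; the running-time part also assumes d ≥ 1. *)

(* Defs.v *)
From HB Require Import structures.
From mathcomp Require Import all_boot all_order all_algebra.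
From mathcomp Require Import all_classical all_reals all_analysis.

Set Implicit Arguments.
Unset Strict Implicit.
Unset Printing Implicit Defensive.
Import Order.TTheory GRing.Theory Num.Theory.
Import numFieldNormedType.Exports.

Local Open Scope classical_set_scope.
Local Open Scope ring_scope.

(* The library norm on matrices is the sup norm, hence this Euclidean one. *)
Definition enorm (R : realType) (d : nat) (v : 'cV[R]_d) : R :=
  Num.sqrt (\sum_i v i 0 ^+ 2).

Section Mode.
Variables (R : realType) (n d : nat).
Implicit Types (p : 'I_n -> 'cV[R]_d) (x : 'cV[R]_d).

Definition kde p x : R := \sum_k expR (- enorm (p k - x) ^+ 2).

(* The supremum is attained: see [kde_max_attained] below. *)
Definition kde_max p : R := sup (range (kde p)).

Definition approx_mode (eps : R) p x : Prop :=
  (1 - eps) * kde_max p <= kde p x.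

End Mode.

Lemma kde_max_attained (R : realType) (n d : nat) (p : 'I_n -> 'cV[R]_d) :
  exists2 x, kde p x = kde_max p & forall y, kde p y <= kde p x.
Proof.
suff [x xmax] : exists x, forall y, kde p y <= kde p x.
  exists x => //; apply/le_anti/andP; split.
    by apply: ub_le_sup; [exists (kde p x) => _ [y _ <-] | exists x].
  by apply: ge_sup => [|_ [y _ <-]//]; exists (kde p x), x.
have enormE (v : 'cV[R]_d) : enorm v ^+ 2 = \sum_i v i 0 ^+ 2.
  by rewrite sqr_sqrtr// sumr_ge0// => i _; exact: sqr_ge0.
case: n p => [|n] p; first by exists 0 => y; rewrite /kde !big_ord0.
pose B : R := \sum_k \sum_i `|p k i 0| + n.+2%:R.
have pB k i : `|p k i 0| <= B - n.+2%:R.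
  rewrite addrK (bigD1 k)//= (bigD1 i)//= -addrA lerDl addr_ge0 ?sumr_ge0//.
  by move=> l _; exact: sumr_ge0.
have csum (I : finType) (F : I -> 'rV[R]_d -> R) :
    (forall i, continuous (F i)) -> continuous (fun x => \sum_i F i x).
  move=> Fc; have -> : (fun x => \sum_i F i x) = \sum_i F i.
    by apply/funext => x; rewrite fct_sumE.
  apply: (big_ind (fun g : 'rV[R]_d -> R => continuous g)) =>
    [|g h gc hc|i _]; last exact: Fc.
    exact: (@cst_continuous _ _ (0 : R)).
  by move=> x; exact: (continuousD (gc x) (hc x)).
pose f (x : 'rV[R]_d) := kde p x^T.
have fc : continuous f.
  have -> : f = fun x : 'rV[R]_d =>
      \sum_k expR (- \sum_i (p k i 0 - x ord0 i) ^+ 2).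
    apply/funext => x; apply: eq_bigr => k _; rewrite enormE.
    by congr (expR (- _)); apply: eq_bigr => i _; rewrite !mxE.
  apply: (csum) => k x.
  apply: (@continuous_comp _ _ _
    (fun x : 'rV[R]_d => - \sum_i (p k i 0 - x ord0 i) ^+ 2) expR);
    last exact: continuous_expR.
  apply: continuousN; move: x; apply: (csum) => i x.
  apply: (@continuous_comp _ _ _ (fun x : 'rV[R]_d => p k i 0 - x ord0 i)
    (fun t => t ^+ 2)); last exact: exprn_continuous.
  by apply: continuousB; [exact: cst_continuous | exact: coord_continuous].
pose K := [set x : 'rV[R]_d | forall i, `[- B, B]%classic (x ord0 i)].
have B0 : 0 <= B by rewrite addr_ge0// sumr_ge0// => k _; rewrite sumr_ge0.
have K0 : K !=set0.
  by exists 0 => i; rewrite /= mxE in_itv/= oppr_le0 B0.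
have Kp k : K (p k)^T.
  move=> i /=; rewrite mxE in_itv/= -ler_norml.
  by apply: le_trans (pB k i) _; rewrite gerBl.
have Kc : compact K by apply: (@rV_compact R d (fun=> `[- B, B]%classic)) => i; exact: segment_compact.
have [c _ cmax] := EVT_max_rV K0 Kc (continuous_subspaceT fc).
exists c^T => y; have [Ky|] := pselect (K y^T).
  by have := cmax y^T; rewrite inE /f trmxK; exact.
move=> /existsNP[i /=]; rewrite mxE in_itv/= -ler_norml => /negP.
rewrite -ltNge => yB.
apply: (@le_trans _ _ 1); last first.
  have := cmax (p ord0)^T; rewrite inE /f trmxK => /(_ (Kp _)).
  apply: le_trans; rewrite /kde big_ord_recl subrr enormE big1 => [|j _].
    by rewrite oppr0 expR0 lerDl sumr_ge0// => j _; exact: expR_ge0.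
  by rewrite mxE expr0n.
rewrite /kde (@le_trans _ _ (\sum_(k < n.+1) n.+1%:R^-1))//; last first.
  by rewrite sumr_const card_ord -[X in X <= _]mulr_natl divff.
apply: ler_sum => k _; rewrite expRN lef_pV2 ?posrE ?expR_gt0//.
apply: le_trans (expR_ge1Dx _); rewrite enormE.
have : n.+1%:R <= `|p k i 0 - y i 0|.
  rewrite distrC; apply: le_trans (lerB_dist _ _).
  rewrite lerBrDr; apply: le_trans (ltW yB).
  rewrite -lerBrDl; apply: le_trans (pB k i) _.
  by rewrite lerD2l lerN2 ler_nat.
move=> h; rewrite (bigD1 i)//= !mxE.
apply: (@le_trans _ _ (`|p k i 0 - y i 0| ^+ 2)).
  rewrite expr2; apply: (le_trans h); rewrite ler_peMr//.
  by apply: le_trans h; rewrite ler1n.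
rewrite real_normK ?num_real//.
rewrite addrCA lerDl addr_ge0// sumr_ge0// => j _; exact: sqr_ge0.
Qed.

Section MeanShift.
Variables (R : realType) (n d m : nat).

Definition project (Pi : 'M[R]_(m, d)) (p : 'I_n -> 'cV[R]_d) :
  'I_n -> 'cV[R]_m := fun k => Pi *m p k.

Definition mean_shift (p : 'I_n -> 'cV[R]_d) (Pi : 'M[R]_(m, d))
    (x : 'cV[R]_m) : 'cV[R]_d :=
  (\sum_k expR (- enorm (x - Pi *m p k) ^+ 2))^-1 *:
  \sum_k expR (- enorm (x - Pi *m p k) ^+ 2) *: p k.

End MeanShift.

Definition jl_gamma (R : realType) (eps rho : R) : R :=
  eps / (4 * ln (4 / (eps * rho))).

Section RandomMatrix.
Variables (R : realType) (disp : measure_display) (T : measurableType disp).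
Variable P : probability T R.

(* For a measurable E this is exactly [q%:E <= P E]; the general form makes
   sense of events that are not known to be measurable. *)
Definition with_prob (q : R) (E : set T) : Prop :=
  exists A : set T, [/\ measurable A, A `<=` E & (q%:E <= P A)%E].

Variables m d : nat.
Implicit Types X : T -> 'M[R]_(m, d).

Definition random_matrix X : Prop :=
  forall i j, measurable_fun [set: T] (fun w => X w i j).

Definition jl_guarantee X (gamma : R) (k : nat) (delta : R) : Prop :=
  forall v : 'I_k -> 'cV[R]_d,
  with_prob (1 - delta) [set w | forall i j,
    enorm (v i - v j) <= enorm (X w *m v i - X w *m v j)
      <= (1 + gamma) * enorm (v i - v j)].

Definition independent_entries X : Prop :=
  forall B : 'I_m -> 'I_d -> set R, (forall i j, measurable (B i j)) ->
  (P [set w | forall i j, B i j (X w i j)] =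
   \prod_i \prod_j P [set w | B i j (X w i j)])%E.

Definition rademacher_matrix X : Prop :=
  [/\ random_matrix X, independent_entries X & forall i j,
      P [set w | X w i j = 1] = (2^-1)%:E /\
      P [set w | X w i j = -1] = (2^-1)%:E].

Definition gaussian_matrix X : Prop :=
  [/\ random_matrix X, independent_entries X & forall i j (B : set R),
      measurable B -> P [set w | B (X w i j)] = normal_prob 0 1 B].

End RandomMatrix.

(* With this scaling the interval [1, 1 + gamma] allowed for |Pi v| / |v| is
   centred at the typical value 1 + gamma / 2. *)
Definition jl_scale (R : realType) (gamma : R) (m : nat) : R :=
  (1 + gamma / 2) / Num.sqrt m%:R.

(* Real-RAM programs.  Each real operation and each draw of one random matrix
   entry costs one unit; data movement and constants are free.  A call passes a
   dataset q : Q to an external subroutine, which answers with an X. *)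
Inductive instr (R : Type) : Type :=
  | IAdd of R & R
  | ISub of R & R
  | IMul of R & R
  | IDiv of R & R
  | IExp of R
  | ILn of R
  | ISqrt of R.

Inductive prog (R I Q X A : Type) : Type :=
  | Ret of A
  | Do of instr R & (R -> prog R I Q X A)
  | Draw of I & (R -> prog R I Q X A)
  | Call of Q & (X -> prog R I Q X A).

Arguments Ret {R I Q X A}.
Arguments Do {R I Q X A}.
Arguments Draw {R I Q X A}.
Arguments Call {R I Q X A}.

Fixpoint bind (R I Q X A B : Type) (c : prog R I Q X A)
    (f : A -> prog R I Q X B) : prog R I Q X B :=
  match c with
  | Ret a => f a
  | Do o k => Do o (fun x => bind (k x) f)
  | Draw i k => Draw i (fun x => bind (k x) f)
  | Call q k => Call q (fun x => bind (k x) f)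
  end.

Declare Scope prog_scope.
Delimit Scope prog_scope with prog.
Notation "'let*' x := c 'in' k" := (bind c (fun x => k))
  (at level 200, x name, c at level 100, k at level 200) : prog_scope.

Section Semantics.
Variables (R : realType) (I Q X A : Type).

Definition exec (o : instr R) : R :=
  match o with
  | IAdd x y => x + y
  | ISub x y => x - y
  | IMul x y => x * y
  | IDiv x y => x / y
  | IExp x => expR x
  | ILn x => ln x
  | ISqrt x => Num.sqrt x
  end.

(* [draws i] is the value of the random entry i, [sub] the subroutine and
   [cost q] the time it takes on the dataset q. *)
Variables (draws : I -> R) (sub : Q -> X) (cost : Q -> nat).

Fixpoint run (c : prog R I Q X A) : A :=
  match c with
  | Ret a => a
  | Do o k => run (k (exec o))
  | Draw i k => run (k (draws i))
  | Call q k => run (k (sub q))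
  end.

Fixpoint time (c : prog R I Q X A) : nat :=
  match c with
  | Ret _ => 0%N
  | Do o k => (time (k (exec o))).+1
  | Draw i k => (time (k (draws i))).+1
  | Call q k => (cost q + time (k (sub q)))%N
  end.

End Semantics.

Section Loops.
Variables (R : realType) (I Q X : Type).
Local Notation M := (prog R I Q X).
Local Open Scope prog_scope.

Definition do_op (o : instr R) : M R := Do o Ret.
Definition draw (i : I) : M R := Draw i Ret.
Definition call (q : Q) : M X := Call q Ret.

Fixpoint tabulate (A : Type) (n : nat) : ('I_n -> M A) -> M ('I_n -> A) :=
  if n is n'.+1 then fun f =>
    let* a := f ord0 in
    let* g := tabulate (fun i : 'I_n' => f (lift ord0 i)) in
    Ret (fun i : 'I_n'.+1 => oapp g a (unlift ord0 i))
  else fun _ => Ret (fun i : 'I_0 => False_rect A (notF (ltn_ord i))).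

Fixpoint sum_loop (n : nat) : ('I_n -> M R) -> M R :=
  if n is n'.+1 then fun f =>
    let* a := f ord0 in
    let* b := sum_loop (fun i : 'I_n' => f (lift ord0 i)) in
    do_op (IAdd a b)
  else fun _ => Ret 0.

End Loops.

Arguments do_op {R I Q X}.
Arguments draw {R I Q X}.
Arguments call {R I Q X}.

Section Procedure.
Variables (R : realType) (n d m : nat).
Local Notation M :=
  (prog R ('I_m * 'I_d) ('I_n -> 'cV[R]_m) 'cV[R]_m).
Local Open Scope prog_scope.

Definition compute_scale (eps rho : R) : M R :=
  let* a := do_op (IMul eps rho) in
  let* b := do_op (IDiv 4 a) in
  let* l := do_op (ILn b) in
  let* e := do_op (IMul 4 l) in
  let* gamma := do_op (IDiv eps e) in
  let* h := do_op (IDiv gamma 2) in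
  let* t := do_op (IAdd 1 h) in
  let* r := do_op (ISqrt m%:R) in
  do_op (IDiv t r).

Definition sample_matrix (s : R) : M 'M[R]_(m, d) :=
  let* Pi := tabulate (fun i : 'I_m => tabulate (fun j : 'I_d =>
    let* a := draw (i, j) in do_op (IMul s a))) in
  Ret (\matrix_(i, j) Pi i j).

Definition compute_projection (Pi : 'M[R]_(m, d)) (p : 'I_n -> 'cV[R]_d) :
    M ('I_n -> 'cV[R]_m) :=
  tabulate (fun k : 'I_n =>
    let* y := tabulate (fun i : 'I_m =>
      sum_loop (fun j : 'I_d => do_op (IMul (Pi i j) (p k j 0)))) in
    Ret (\col_i y i)).

Definition compute_weight (x q : 'cV[R]_m) : M R :=
  let* r := sum_loop (fun i : 'I_m =>
    let* t := do_op (ISub (x i 0) (q i 0)) in do_op (IMul t t)) in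
  let* s := do_op (ISub 0 r) in
  do_op (IExp s).

Definition compute_mean (p : 'I_n -> 'cV[R]_d) (w : 'I_n -> R) :
    M 'cV[R]_d :=
  let* W := sum_loop (fun k : 'I_n => Ret (w k)) in
  let* x := tabulate (fun j : 'I_d =>
    let* s := sum_loop (fun k : 'I_n => do_op (IMul (w k) (p k j 0))) in
    do_op (IDiv s W)) in
  Ret (\col_j x j).

Definition jl_mode_procedure (eps rho : R) (p : 'I_n -> 'cV[R]_d) :
    M 'cV[R]_d :=
  let* s := compute_scale eps rho in
  let* Pi := sample_matrix s in
  let* q := compute_projection Pi p in
  let* x := call q in
  let* w := tabulate (fun k : 'I_n => compute_weight x (q k)) in
  compute_mean p w.

End Procedure.

(* A (1 - eps)-approximate mode finder for n points in R^m with worst-case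
   running time at most t. *)
Definition mode_solver (R : realType) (n m : nat) (eps : R) (t : nat)
    (sub : ('I_n -> 'cV[R]_m) -> 'cV[R]_m) (cost : ('I_n -> 'cV[R]_m) -> nat) :
    Prop :=
  forall q, approx_mode eps q (sub q) /\ (cost q <= t)%N.

(* Main.v *)
(** The map A sending p to Pi p does not shrink distances between data points.
    With weights w_k = exp (-|x'' - A p_k|^2) and their barycentre x',
    convexity of exp gives

      G_P(x') >= sum_k w_k (1 + |x'' - A p_k|^2 - |p_k - x'|^2),

    and sum_k w_k |p_k - x'|^2 is a weighted sum of |p_k - p_l|^2 over pairs,
    hence at most sum_k w_k |A p_k - x''|^2; so G_P(x') >= G_{AP}(x'').
    Conversely A stretches the distances to the mode z by at most 1 + gamma,
    and G_{AP}(A z) >= (1 - eps / 2) G_P(z) because the mean of |p_k - z|^2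
    under the weights exp (-|p_k - z|^2) is at most ln (1 / rho), an entropy
    bound.

    For the random matrices, let u be a unit vector and Y_i the i-th coordinate
    of X u.  Independence enters only through the moment generating function
    E exp (sum_i s_i Y_i) = prod_i M(s_i), with 1 + s^2/2 <= M(s) <= exp (s^2/2)
    in both the Rademacher and the Gaussian case.  The upper tail of
    sum_i Y_i^2 follows by averaging exp (sqrt (2 l) t y) over a Gaussian t,
    the lower tail by bounding exp (- l y^2) above by a finite combination of
    exponentials of y; a union bound over pairs of points concludes. *)

Require Import Defs.
From mathcomp Require Import all_boot all_order all_algebra.
From mathcomp Require Import all_classical all_reals all_analysis.
From mathcomp Require Import measurable_realfun ring lra zify.
Set Implicit Arguments.
Unset Strict Implicit.
Unset Printing Implicit Defensive.
Import Order.TTheory GRing.Theory Num.Theory.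
Import numFieldNormedType.Exports.
Local Open Scope classical_set_scope.
Local Open Scope ring_scope.

(** * Values and costs of the program combinators *)

Section Programs.
Variables (R : realType) (I Q X : Type).
Variables (draws : I -> R) (sub : Q -> X) (cost : Q -> nat).
Implicit Types (n : nat).

Lemma run_bind (A B : Type) (c : prog R I Q X A) (f : A -> prog R I Q X B) :
  run draws sub (bind c f) = run draws sub (f (run draws sub c)).
Proof. by elim: c => //= *. Qed.

Lemma time_bind (A B : Type) (c : prog R I Q X A) (f : A -> prog R I Q X B) :
  time draws sub cost (bind c f) =
  (time draws sub cost c + time draws sub cost (f (run draws sub c)))%N.
Proof. by elim: c => [|? k IH|? k IH|? k IH] //=; rewrite IH ?addnA. Qed.

Lemma run_tabulate (A : Type) n (f : 'I_n -> prog R I Q X A) :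
  run draws sub (tabulate f) = fun i => run draws sub (f i).
Proof.
elim: n f => [|n IH] f; first by apply/funext => -[].
rewrite /= run_bind run_bind/= IH; apply/funext => i.
by case: unliftP => [j|] ->.
Qed.

Lemma time_tabulate (A : Type) n (f : 'I_n -> prog R I Q X A) (t : nat) :
  (forall i, time draws sub cost (f i) = t) ->
  time draws sub cost (tabulate f) = (n * t)%N.
Proof.
elim: n f => [|n IH] f ft //=.
by rewrite time_bind time_bind/= IH ?ft// addn0 mulSn.
Qed.

Lemma run_sum_loop n (f : 'I_n -> prog R I Q X R) :
  run draws sub (sum_loop f) = \sum_i run draws sub (f i).
Proof.
elim: n f => [|n IH] f; first by rewrite big_ord0.
by rewrite /= run_bind run_bind/= IH big_ord_recl.
Qed.

(** Every term also pays for one addition, the last one being added to 0; hence [t.+1]. *)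
Lemma time_sum_loop n (f : 'I_n -> prog R I Q X R) (t : nat) :
  (forall i, time draws sub cost (f i) = t) ->
  time draws sub cost (sum_loop f) = (n * t.+1)%N.
Proof.
elim: n f => [|n IH] f ft //=.
by rewrite time_bind time_bind/= IH ?ft// addn1 addnS mulSn addSn.
Qed.

End Programs.

Lemma enorm_sqr (R : realType) (d : nat) (v : 'cV[R]_d) :
  enorm v ^+ 2 = \sum_i v i 0 ^+ 2.
Proof. by rewrite sqr_sqrtr// sumr_ge0// => i _; exact: sqr_ge0. Qed.

(** * Output and running time of the procedure *)

Section Procedure.
Variables (R : realType) (n d m : nat) (eps rho : R) (p : 'I_n -> 'cV[R]_d).
Variables (sub : ('I_n -> 'cV[R]_m) -> 'cV[R]_m).
Variables (cost : ('I_n -> 'cV[R]_m) -> nat).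
Variable draws : 'I_m * 'I_d -> R.
Let Pi := jl_scale (jl_gamma eps rho) m *: \matrix_(i, j) draws (i, j).

Lemma run_jl_mode_procedure : run draws sub (jl_mode_procedure m eps rho p) =
  mean_shift p Pi (sub (project Pi p)).
Proof.
rewrite /jl_mode_procedure run_bind.
have -> : run draws sub (compute_scale n d m eps rho) =
  jl_scale (jl_gamma eps rho) m by [].
rewrite run_bind.
have -> : run draws sub (sample_matrix n d m (jl_scale (jl_gamma eps rho) m))
    = Pi.
  rewrite /sample_matrix run_bind/= run_tabulate.
  by apply/matrixP => i j; rewrite !mxE run_tabulate.
rewrite run_bind.
have -> : run draws sub (compute_projection Pi p) = project Pi p.
  rewrite /compute_projection run_tabulate; apply/funext => k.
  rewrite run_bind/= run_tabulate; apply/colP => i.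
  by rewrite !mxE run_sum_loop; apply: eq_bigr.
rewrite run_bind/= run_bind run_tabulate.
have -> : (fun k => run draws sub (@compute_weight R n d m
      (sub (project Pi p)) (project Pi p k))) =
    (fun k => expR (- enorm (sub (project Pi p) - Pi *m p k) ^+ 2)).
  apply/funext => k; rewrite /compute_weight !run_bind/= run_sum_loop.
  rewrite sub0r enorm_sqr; congr (expR (- _)); apply: eq_bigr => i _.
  by rewrite /= !mxE expr2.
rewrite /compute_mean !run_bind/= run_tabulate run_sum_loop.
apply/colP => j; rewrite !mxE run_bind/= run_sum_loop mulrC summxE.
by congr (_ * _); apply: eq_bigr => k _; rewrite !mxE.
Qed.

Lemma time_jl_mode_procedure (t : nat) :
  (0 < n)%N -> (0 < d)%N -> (0 < m)%N -> (forall q, (cost q <= t)%N) ->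
  (time draws sub cost (jl_mode_procedure m eps rho p) <=
   22 * (n * d * m) + t)%N.
Proof.
move=> n0 d0 m0 costt; rewrite /jl_mode_procedure time_bind.
have -> : time draws sub cost (compute_scale n d m eps rho) = 9%N by [].
set s := run _ _ (compute_scale _ _ _ _ _).
rewrite time_bind.
have -> : time draws sub cost (sample_matrix n d m s) = (m * (d * 2))%N.
  rewrite /sample_matrix time_bind/= addn0; apply: time_tabulate => i.
  by apply: time_tabulate => j.
set A := run _ _ (sample_matrix _ _ _ _).
rewrite time_bind.
have -> : time draws sub cost (compute_projection A p) = (n * (m * (d * 2)))%N.
  apply: time_tabulate => k; rewrite time_bind/= addn0.
  by apply: time_tabulate => i; apply: time_sum_loop => j.
set q := run _ _ (compute_projection _ _).
rewrite time_bind.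
have -> : time draws sub cost (call q) = cost q by rewrite /= addn0.
set x := run _ _ (call q); rewrite time_bind.
have -> : time draws sub cost (tabulate (fun k : 'I_n =>
    compute_weight n d x (q k))) = (n * (m * 3 + 2))%N.
  apply: time_tabulate => k; rewrite /compute_weight !time_bind/=.
  by rewrite (@time_sum_loop _ _ _ _ _ _ _ _ _ 2).
set w := run _ _ (tabulate _).
have -> : time draws sub cost (compute_mean m p w) = (n + d * (n * 2 + 1))%N.
  rewrite /compute_mean !time_bind/= (@time_sum_loop _ _ _ _ _ _ _ _ _ 0)//.
  rewrite muln1 addn0; congr addn; apply: time_tabulate => j.
  by rewrite time_bind/= (@time_sum_loop _ _ _ _ _ _ _ _ _ 1).
(* The total is [cost q] plus 9 + 2md + 2nmd + 3nm + 2n + n + 2nd + d. As n, d, m >= 1, each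
   monomial is at most ndm, and the coefficients add up to 22. *)
have := costt q; nia.
Qed.

End Procedure.

(** * Euclidean geometry of the mean-shift step *)

Section Euclid.
Variables (R : realType) (d : nat).
Implicit Types v : 'cV[R]_d.

Lemma enorm_ge0 v : 0 <= enorm v. Proof. exact: sqrtr_ge0. Qed.

Lemma enormN v : enorm (- v) = enorm v.
Proof.
by congr Num.sqrt; apply: eq_bigr => i _; rewrite mxE sqrrN.
Qed.

Lemma enorm_subC (u v : 'cV[R]_d) : enorm (u - v) = enorm (v - u).
Proof. by rewrite -enormN opprB. Qed.

Lemma enormZ (a : R) v : 0 <= a ->
  enorm (a *: v) = a * enorm v.
Proof.
move=> a0; rewrite /enorm.
under eq_bigr do rewrite mxE exprMn.
by rewrite -mulr_sumr sqrtrM ?sqr_ge0// sqrtr_sqr ger0_norm.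
Qed.

(* At the barycentre x of the weighted family the last term vanishes. *)
Lemma sum_dist_pairs n (w : 'I_n -> R) (p : 'I_n -> 'cV[R]_d) (x : 'cV[R]_d) :
  \sum_k \sum_l w k * w l * enorm (p k - p l) ^+ 2 =
  2 * ((\sum_k w k) * (\sum_k w k * enorm (p k - x) ^+ 2)
       - enorm (\sum_k w k *: (p k - x)) ^+ 2).
Proof.
under eq_bigr => k _ do under eq_bigr => l _ do rewrite enorm_sqr mulr_sumr.
under eq_bigr => k _ do rewrite exchange_big/=.
rewrite exchange_big/=.
under [X in _ = 2 * (_ * X - _)]eq_bigr => k _ do rewrite enorm_sqr mulr_sumr.
rewrite [X in _ = 2 * (_ * X - _)]exchange_big/= enorm_sqr mulr_sumr -sumrB.
rewrite mulr_sumr; apply: eq_bigr => i _.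
(* Both points are measured from x, which cancels in their difference; the square then splits into
   products of functions of k and of l. *)
rewrite summxE; pose a k := p k i 0 - x i 0.
rewrite (eq_bigr (fun k => \sum_l (w k * a k ^+ 2 * w l + w k * (w l * a l ^+ 2)
    - 2 * (w k * a k) * (w l * a l)))); last first.
  by move=> k _; apply: eq_bigr => l _; rewrite !mxE /a; ring.
rewrite (eq_bigr (fun k => w k * a k ^+ 2 * (\sum_l w l) +
    w k * (\sum_l w l * a l ^+ 2) - 2 * (w k * a k) * (\sum_l w l * a l)));
  last first.
  by move=> k _; rewrite !mulr_sumr -big_split/= -sumrB.
rewrite sumrB big_split/= -!mulr_suml -[in X in _ - X * _]mulr_sumr.
have -> : \sum_k w k * (p k - x) i 0 ^+ 2 = \sum_k w k * a k ^+ 2.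
  by apply: eq_bigr => k _; rewrite !mxE.
rewrite [X in _ - X ^+ 2](_ : _ = \sum_k w k * a k); last first.
  by apply: eq_bigr => k _; rewrite !mxE.
ring.
Qed.

End Euclid.

Section MeanShiftGain.
Variables (R : realType) (n d m : nat) (p : 'I_n -> 'cV[R]_d).
Variable A : 'M[R]_(m, d).
Hypothesis A_expand : forall k l, enorm (p k - p l) <= enorm (A *m p k - A *m p l).

(* Among all centres, the barycentre minimises the weighted sum of squared
   distances, which is a sum over pairs and hence does not increase under the
   inverse of A. *)
Lemma kde_mean_shift (x : 'cV[R]_m) :
  kde (project A p) x <= kde p (mean_shift p A x).
Proof.
have [n0|n0] := posnP n.
  by rewrite /kde !big1// => i; have := ltn_ord i; rewrite [X in (_ < X)%N]n0.
pose w k : R := expR (- enorm (x - A *m p k) ^+ 2).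
pose W := \sum_k w k.
have w0 k : 0 < w k by exact: expR_gt0.
have W0 : 0 < W.
  by rewrite /W (bigD1 (Ordinal n0))//= ltr_pwDl ?sumr_ge0// => k _; exact: ltW.
pose y := mean_shift p A x.
have yE : \sum_k w k *: (p k - y) = 0.
  under eq_bigr => k _ do rewrite scalerBr.
  rewrite sumrB -scaler_suml -/W /y /mean_shift -/W scalerA divff ?gt_eqF//.
  by rewrite scale1r subrr.
have var : \sum_k w k * enorm (p k - y) ^+ 2 <=
           \sum_k w k * enorm (A *m p k - x) ^+ 2.
  rewrite -(ler_pM2l W0) -(ler_pM2l (ltr0Sn R 1)).
  have := sum_dist_pairs w p y; rewrite yE.
  rewrite (_ : enorm 0 ^+ 2 = 0) ?subr0; last first.
    by rewrite enorm_sqr big1// => i _; rewrite mxE expr0n.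
  move=> <-.
  apply: (@le_trans _ _ (\sum_k \sum_l w k * w l *
      enorm (A *m p k - A *m p l) ^+ 2)).
    apply: ler_sum => k _; apply: ler_sum => l _.
    rewrite ler_pM2l ?mulr_gt0// ler_pXn2r ?nnegrE ?enorm_ge0//.
  rewrite (sum_dist_pairs w (fun k => A *m p k) x) ler_pM2l//.
  by rewrite gerBl sqr_ge0.
rewrite /kde /project; apply: (@le_trans _ _
  (\sum_k w k * (1 + enorm (A *m p k - x) ^+ 2 - enorm (p k - y) ^+ 2))).
  rewrite -[X in X <= _]addr0.
  under [X in _ <= X]eq_bigr => k _ do rewrite -addrA mulrDr mulr1 mulrBr.
  rewrite big_split/= sumrB; apply: lerD; last by rewrite subr_ge0.
  by apply: ler_sum => k _; rewrite /w enorm_subC.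
apply: ler_sum => k _.
rewrite [leRHS](_ : _ = w k *
    expR (enorm (A *m p k - x) ^+ 2 - enorm (p k - y) ^+ 2)); last first.
  by rewrite /w -expRD (enorm_subC x) addKr.
by rewrite ler_pM2l// -addrA expR_ge1Dx.
Qed.

End MeanShiftGain.

Lemma ln_le_sub1 (R : realType) (x : R) : 0 < x -> ln x <= x - 1.
Proof.
move=> x0; have := @le_ln1Dx R (x - 1).
by rewrite addrCA subrr addr0; apply; rewrite ltrBrDr addNr.
Qed.

(** * Loss of density when distances are stretched *)

Section Contraction.
Variables (R : realType) (n : nat).

(** With u = [expR (- r k)], the bound [ln x <= x - 1] at x = rho / u gives u * (ln rho + r k) <=
    rho - u. Summed over k, the right-hand side is at most 0 by the hypothesis on rho. *)
Lemma entropy_le (r : 'I_n -> R) (rho : R) : 0 < rho ->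
  rho * n%:R <= \sum_k expR (- r k) ->
  \sum_k expR (- r k) * r k <= - ln rho * \sum_k expR (- r k).
Proof.
move=> rho0 rhoS.
apply: (@le_trans _ _ (\sum_k (rho - expR (- r k) - ln rho * expR (- r k)))).
  apply: ler_sum => k _; set u := expR _.
  have u0 : 0 < u by exact: expR_gt0.
  have : ln (rho / u) <= rho / u - 1 by rewrite ln_le_sub1// divr_gt0.
  have lnu : ln u = - r k by rewrite expRK.
  rewrite lnM ?posrE ?invr_gt0// lnV ?posrE// lnu opprK => h.
  have := ler_wpM2l (ltW u0) h.
  by rewrite mulrBr [u * (_ / _)]mulrC divfK ?gt_eqF//; lra.
rewrite !sumrB -mulr_sumr sumr_const card_ord -mulr_natr; lra.
Qed.

(** The tangent bound 1 - g * r k <= [expR (- (g * r k))] reduces the loss to g times the weighted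
    sum controlled by [entropy_le]. *)
Lemma sum_expR_scale (r : 'I_n -> R) (eps rho g : R) :
  0 < eps -> 0 < rho -> rho * n%:R <= \sum_k expR (- r k) ->
  0 <= g -> - ln rho * g <= eps ->
  (1 - eps) * \sum_k expR (- r k) <= \sum_k expR (- ((1 + g) * r k)).
Proof.
move=> eps0 rho0 rhoS g0 ge.
have S0 : 0 <= \sum_k expR (- r k) by rewrite sumr_ge0// => k _; exact: expR_ge0.
apply: (@le_trans _ _ (\sum_k expR (- r k) * (1 - g * r k))); last first.
  apply: ler_sum => k _; rewrite mulrDl mul1r opprD expRD ler_pM2l ?expR_gt0//.
  exact: expR_ge1Dx.
under [X in _ <= X]eq_bigr => k _ do rewrite mulrBr mulr1 mulrCA.
have := entropy_le rho0 rhoS.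
rewrite sumrB -mulr_sumr.
set S := \sum_k expR (- r k); set E := \sum_k expR (- r k) * r k => ES.
have : g * E <= g * (- ln rho * S) by rewrite ler_wpM2l.
have : (- ln rho * g) * S <= eps * S by rewrite ler_wpM2r.
lra.
Qed.

End Contraction.

Section KdeBounds.
Variables (R : realType) (n d : nat) (p : 'I_n -> 'cV[R]_d).

Lemma kde_ge0 (x : 'cV[R]_d) : 0 <= kde p x.
Proof. by rewrite sumr_ge0// => k _; exact: expR_ge0. Qed.

Lemma kde_le_max (x : 'cV[R]_d) : kde p x <= kde_max p.
Proof. by have [y <-] := kde_max_attained p. Qed.

Lemma kde_max_le_size : kde_max p <= n%:R.
Proof.
have [x <- _] := kde_max_attained p.
rewrite -[n in n%:R]card_ord -sumr_const.
by apply: ler_sum => k _; rewrite -expR0 ler_expR oppr_le0 sqr_ge0.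
Qed.

End KdeBounds.

(** * Approximate modes of the projected data *)

Section Transfer.
Variables (R : realType) (n d m : nat) (p : 'I_n -> 'cV[R]_d).
Variables (eps rho : R).
Hypotheses (eps0 : 0 < eps) (rho0 : 0 < rho) (rho_max : rho * n%:R <= kde_max p).

(** The mean-shift step loses nothing; one factor [1 - eps / 2] comes from the quality of x, another
    from the stretching of distances to z, and 1 - eps <= (1 - eps / 2)^2. *)
Lemma approx_mode_project (A : 'M[R]_(m, d)) (z : 'cV[R]_d) (x : 'cV[R]_m) :
  kde p z = kde_max p ->
  (forall k l, enorm (p k - p l) <= enorm (A *m p k - A *m p l)) ->
  (forall k, enorm (A *m p k - A *m z) <=
    (1 + jl_gamma eps rho) * enorm (p k - z)) ->
  approx_mode (eps / 2) (project A p) x ->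
  approx_mode eps p (mean_shift p A x).
Proof.
move=> zmax A_expand A_z; rewrite /approx_mode => x_mode.
have M0 : 0 <= kde_max p by rewrite -zmax kde_ge0.
(* For eps >= 1 the required bound is at most 0; afterwards [1 - eps / 2] is positive. *)
have [eps1|eps1] := lerP 1 eps.
  apply: le_trans (kde_ge0 _ _).
  by rewrite mulr_le0_ge0// subr_le0.
apply: le_trans (kde_mean_shift A_expand x).
apply: le_trans x_mode.
have [n0|n0] := posnP n.
  have -> : kde_max p = 0.
    by apply/le_anti; rewrite M0 andbT (le_trans (kde_max_le_size p))// n0.
  by rewrite mulr0 mulr_ge0 ?subr_ge0//; [lra|exact: le_trans (kde_ge0 _ 0) (kde_le_max _ 0)].
have rho1 : rho <= 1.
  by rewrite -(@ler_pM2r _ n%:R) ?ltr0n// mul1r (le_trans rho_max)// kde_max_le_size.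
set g := jl_gamma eps rho in A_z *.
have lnrho : 0 <= - ln rho by rewrite oppr_ge0 ln_le0.
have L1 : - ln rho + 1 <= ln (4 / (eps * rho)).
  rewrite lnM ?posrE ?invr_gt0 ?mulr_gt0// lnV ?posrE ?mulr_gt0//.
  rewrite lnM ?posrE// opprD.
  have : ln eps <= 0 by rewrite ln_le0// ltW.
  have : 1 <= ln (4 : R).
    rewrite -[X in X <= _]expRK ler_ln ?posrE ?expR_gt0//.
    (* From 1 - 1/2 <= [expR (- 2^-1)] follows [expR (2^-1)] <= 2, hence e <= 4. *)
    have -> : expR 1 = expR (2^-1) ^+ 2 :> R.
      by rewrite expr2 -expRD; congr expR; lra.
    have : expR (2^-1) * expR (- 2^-1) = 1 :> R by rewrite -expRD subrr expR0.
    have := expR_ge1Dx (- 2^-1 : R); have := expR_gt0 (2^-1 : R).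
    rewrite expr2; nra.
  lra.
have gE : g * (4 * ln (4 / (eps * rho))) = eps.
  by rewrite /g /jl_gamma divfK// gt_eqF// mulr_gt0//; lra.
have g0 : 0 < g by rewrite divr_gt0// mulr_gt0//; lra.
have g1 : g <= 1 / 4.
  have : g * 4 <= g * (4 * ln (4 / (eps * rho))) by rewrite ler_pM2l//; lra.
  lra.
apply: (@le_trans _ _ ((1 - eps / 2) * ((1 - eps / 2) * kde p z))).
  rewrite mulrA zmax ler_wpM2r//.
  have := sqr_ge0 eps; rewrite expr2; nra.
rewrite ler_wpM2l//; first by lra.
apply: le_trans (kde_le_max (project A p) (A *m z)).
apply: (@le_trans _ _
    (\sum_k expR (- ((1 + (2 * g + g ^+ 2)) * enorm (p k - z) ^+ 2)))).
  apply: (@sum_expR_scale _ _ (fun k => enorm (p k - z) ^+ 2) (eps / 2) rho).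
  - by rewrite divr_gt0.
  - by [].
  - by rewrite (le_trans rho_max)// -zmax.
  - by have := sqr_ge0 g; lra.
  (* What remains is [- ln rho * (2 * g + g ^+ 2) <= eps / 2]; the [+ 1] in [L1] leaves room 2 * g
     for the term in [g ^+ 2]. *)
  have : - ln rho * g <= eps / 4.
    have : g * (4 * (- ln rho)) <= g * (4 * ln (4 / (eps * rho))).
      by rewrite ler_pM2l//; lra.
    lra.
  have : g * (4 * (- ln rho + 1)) <= g * (4 * ln (4 / (eps * rho))).
    by rewrite ler_pM2l//; lra.
  rewrite gE expr2; nra.
apply: ler_sum => k _; rewrite ler_expR lerN2 /project.
have -> : 1 + (2 * g + g ^+ 2) = (1 + g) ^+ 2 by ring.
by rewrite -exprMn ler_pXn2r ?nnegrE ?enorm_ge0// mulr_ge0 ?enorm_ge0//; lra.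
Qed.

End Transfer.

(** * From the distortion event to the probabilistic guarantee *)

Section WithProb.
Variables (R : realType) (disp : measure_display) (T : measurableType disp).
Variable P : probability T R.

Lemma with_probS (q : R) (E F : set T) :
  E `<=` F -> with_prob P q E -> with_prob P q F.
Proof.
by move=> EF [A [mA AE qA]]; exists A; split => //; exact: subset_trans AE EF.
Qed.

(** The distortion event concerns n + 1 fixed points only, so on it the conclusion holds for every
    x'', even one that depends on the random matrix. *)
Lemma jl_approx_mode (n d m : nat) (p : 'I_n -> 'cV[R]_d) (eps delta rho : R)
    (Pi : T -> 'M[R]_(m, d)) :
  0 < eps -> 0 < rho -> rho * n%:R <= kde_max p ->
  jl_guarantee P Pi (jl_gamma eps rho) n.+1 delta ->
  with_prob P (1 - delta) [set w | forall x'' : 'cV[R]_m,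
    approx_mode (eps / 2) (project (Pi w) p) x'' ->
    approx_mode eps p (mean_shift p (Pi w) x'')].
Proof.
move=> eps0 rho0 rho_max jl.
have [z zmax _] := kde_max_attained p.
(* Index [ord0] is the mode z; the data points follow, shifted by [lift ord0]. *)
apply: with_probS (jl (fun i => oapp p z (unlift ord0 i))) => w /= jlw x.
apply: (approx_mode_project eps0 rho0 rho_max zmax) => [k l|k].
  by have /andP[+ _] := jlw (lift ord0 k) (lift ord0 l); rewrite !liftK.
by have /andP[_] := jlw (lift ord0 k) ord0; rewrite liftK unlift_none.
Qed.

End WithProb.

(** * Change of variables and products of independent factors *)

Section IntegralTransfer.
Variables (R : realType) (d1 d2 : measure_display).
Variables (T : measurableType d1) (U : measurableType d2).
Variables (mu : {measure set T -> \bar R}) (nu : {measure set U -> \bar R}).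
Import HBNNSimple.

(* Both sides are linear and continuous along increasing sequences in f, so
   that indicators suffice. *)
Lemma ge0_integral_transfer (X : T -> U) (h : T -> R) (c : R) :
  measurable_fun setT X -> measurable_fun setT h -> (forall w, 0 <= h w) ->
  0 <= c ->
  (forall B, measurable B ->
    (\int[mu]_w (h w * \1_B (X w))%:E = c%:E * nu B)%E) ->
  forall f : U -> R, measurable_fun setT f -> (forall x, 0 <= f x) ->
  (\int[mu]_w (h w * f (X w))%:E = c%:E * \int[nu]_x (f x)%:E)%E.
Proof.
move=> mX mh h0 c0 hB f mf f0.
have mEf : measurable_fun setT (EFin \o f) by exact/measurable_EFinP.
have Ef0 x : [set: U] x -> (0 <= (EFin \o f) x)%E by rewrite lee_fin.
pose g := nnsfun_approx measurableT mEf.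
have mgX n : measurable_fun setT (g n \o X) by exact: measurableT_comp.
have gcvg x : (g n x)%:E @[n --> \oo] --> (f x)%:E.
  exact: (@cvg_nnsfun_approx _ _ _ _ measurableT _ mEf Ef0 x Logic.I).
have gnd x : {homo (fun n => g n x) : a b / (a <= b)%N >-> a <= b}.
  by move=> a b ab; exact/lefP/nd_nnsfun_approx.
have mind n r : measurable_fun setT (fun w => \1_(g n @^-1` [set r]) (X w) : R).
  apply: (@measurable_indic _ T R setT (X @^-1` (g n @^-1` [set r]))).
  by rewrite -(setTI (X @^-1` _)); exact: mX.
have gind0 n k x : 0 <= k * \1_(g n @^-1` [set k]) x.
  by have := nnfun_muleindic_ge0 (g n) k x; rewrite lee_fin.
(* Monotone convergence on both sides reduces f to the simple functions [g n]. *)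
transitivity (limn (fun n => \int[mu]_w (h w * g n (X w))%:E)%E).
  rewrite -monotone_convergence//.
  - apply: eq_integral => w _; apply/esym/cvg_lim => //.
    under eq_fun do rewrite EFinM.
    by rewrite EFinM; apply: cvgeZl.
  - by move=> n; apply/measurable_EFinP; exact: measurable_funM (mgX n).
  - by move=> n w _; rewrite lee_fin mulr_ge0.
  - by move=> w _ a b ab; rewrite lee_fin ler_wpM2l//; exact: gnd.
rewrite -ge0_integralZl//.
transitivity (limn (fun n => \int[nu]_x (c%:E * (g n x)%:E))%E); last first.
  rewrite -monotone_convergence//.
  - by apply: eq_integral => x _; apply/cvg_lim => //; apply: cvgeZl.
  - by move=> n; apply: measurable_funeM; apply/measurable_EFinP.
  - by move=> n x _; rewrite mule_ge0// lee_fin.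
  - by move=> x _ a b ab; rewrite lee_wpmul2l// lee_fin; exact: gnd.
congr (limn _); apply/funext => n.
(* A simple function is the sum of its values times the indicators of its fibres; [hB] settles each
   fibre. *)
transitivity (\sum_(k \in range (g n))
    \int[mu]_w (k * (h w * \1_(g n @^-1` [set k]) (X w)))%:E)%E.
  rewrite -ge0_integral_fsum//.
  - apply: eq_integral => w _; rewrite fsumEFin//; congr EFin.
    rewrite {1}(fimfunE (g n)) mulrC mulr_fsuml; apply: eq_fsbigr => k _.
    by rewrite -mulrA; congr (_ * _); exact: mulrC.
  - move=> k; apply/measurable_EFinP; apply: measurable_funM => //.
    by apply: measurable_funM => //; exact: mind.
  - by move=> k w _; rewrite lee_fin mulrCA mulr_ge0.
transitivity (\sum_(k \in range (g n))
    (c%:E * \int[nu]_x (k * \1_(g n @^-1` [set k]) x)%:E))%E; last first.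
  rewrite -ge0_mule_fsumr; last first.
    by move=> k; apply: integral_ge0 => x _; rewrite lee_fin.
  rewrite -ge0_integral_fsum//.
  - rewrite -ge0_integralZl//; last 2 first.
    + apply: emeasurable_fsum => // k; apply/measurable_EFinP.
      exact: measurable_funM.
    + by move=> x _; rewrite fsume_ge0// => k _; rewrite lee_fin.
    apply: eq_integral => x _; congr (_ * _)%E; rewrite fsumEFin//.
    by congr EFin; rewrite [RHS](fimfunE (g n)).
  - by move=> k; apply/measurable_EFinP; apply: measurable_funM.
  - by move=> k x _; rewrite lee_fin.
apply: eq_fsbigr => k /[!inE] -[y _ <-]; set r := g n y.
have r0 : 0 <= r by [].
under eq_integral do rewrite EFinM.
rewrite ge0_integralZl//; last 2 first.
  - by apply/measurable_EFinP; apply: measurable_funM.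
  - by move=> w _; rewrite lee_fin mulr_ge0.
rewrite hB//.
under [in RHS]eq_integral do rewrite EFinM.
rewrite ge0_integralZl//; last exact/measurable_EFinP.
by rewrite muleCA integral_indic// setIT.
Qed.

End IntegralTransfer.

Section Independence.
Variables (R : realType) (disp : measure_display) (T : measurableType disp).
Variable P : probability T R.

(** Independence is the case where every factor is an indicator. The factors are released from that
    restriction one at a time: [ge0_integral_transfer] passes from indicators to nonnegative
    functions, with the product of the other factors as weight. *)
Lemma integral_prod_indep (I : finType) (X : I -> T -> R) :
  (forall i, measurable_fun setT (X i)) ->
  (forall B : I -> set R, (forall i, measurable (B i)) ->
    (P [set w | forall i, B i (X i w)] =
     \prod_i P [set w | B i (X i w)])%E) ->
  forall (f : I -> R -> R) (e : I -> R),
  (forall i, measurable_fun setT (f i)) -> (forall i x, 0 <= f i x) ->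
  (forall i, (\int[P]_w (f i (X i w))%:E = (e i)%:E)%E) ->
  (\int[P]_w (\prod_i f i (X i w))%:E = (\prod_i e i)%:E)%E.
Proof.
move=> mX indep.
(* Only the indices in s may carry general functions. *)
suff H (s : seq I) (f : I -> R -> R) (e : I -> R) :
    (forall i, measurable_fun setT (f i)) -> (forall i x, 0 <= f i x) ->
    (forall i, (\int[P]_w (f i (X i w))%:E = (e i)%:E)%E) ->
    (forall i, i \notin s -> exists2 B, measurable B & f i = \1_B) ->
    (\int[P]_w (\prod_i f i (X i w))%:E = (\prod_i e i)%:E)%E.
  move=> f e mf f0 fe; apply: (H (enum I) f e) => // i.
  by rewrite mem_enum.
have mXB i B : measurable B -> measurable (X i @^-1` B).
  by move=> mB; rewrite -(setTI (X i @^-1` _)); exact: mX.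
elim: s f e => [|i s IH] f e mf f0 fe find.
  have {find} /choice[B BE] : forall i, exists B, measurable B /\ f i = \1_B.
    by move=> i; have [//|B mB fB] := find i; exists B.
  transitivity (\int[P]_w (\1_[set w | forall i, B i (X i w)] w)%:E)%E.
    apply: eq_integral => w _; congr EFin; rewrite indicE.
    case: (boolP (w \in _)) => [|]; rewrite ?notin_setE ?inE/=.
      by move=> wB; rewrite big1// => i _; rewrite (BE i).2 indicE mem_set.
    move=> /existsNP[i nB]; rewrite (bigD1 i)//= (BE i).2 indicE memNset//.
    by rewrite mul0r.
  rewrite integral_indic ?setIT; last 2 first.
  - exact: measurableT.
  - rewrite (_ : [set w | _] = \bigcap_(i in [set: I]) (X i @^-1` B i)).
      by apply: fin_bigcap_measurable => // i _; apply: mXB; exact: (BE i).1.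
    by apply/seteqP; split => w /= wB i; [move=> _; exact: wB | exact: wB].
  have := indep B (fun i => (BE i).1) => /= ->.
  rewrite -prodEFin; apply: eq_bigr => i _; rewrite -fe (BE i).2.
  by rewrite (integral_indic _ measurableT (mXB _ _ (BE i).1)) setIT.
pose h w := \prod_(j | j != i) f j (X j w).
have h0 w : 0 <= h w by exact: prodr_ge0.
have mh : measurable_fun setT h.
  rewrite /h; under eq_fun do rewrite -big_filter.
  by apply: measurable_prod => j _; exact: measurableT_comp.
have e0 j : 0 <= e j.
  by rewrite -lee_fin -fe integral_ge0// => w _; rewrite lee_fin.
transitivity (\int[P]_w (h w * f i (X i w))%:E)%E.
  by apply: eq_integral => w _; rewrite (bigD1 i)//= mulrC.
have hXi B : measurable B ->
  (\int[P]_w (h w * \1_B (X i w))%:E =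
   (\prod_(j | j != i) e j)%:E * pushforward P (X i) B)%E; last first.
  rewrite (ge0_integral_transfer (mX i) mh h0 _ hXi)//; last exact: prodr_ge0.
  rewrite ge0_integral_pushforward//; last 2 first.
  - exact/measurable_EFinP.
  - by move=> x _; rewrite lee_fin.
  by rewrite preimage_setT/= fe -EFinM [in RHS](bigD1 i)//= mulrC.
move=> mB; rewrite /pushforward.
(* With [\1_B] in place of [f i], the index i joins the indicators and the induction hypothesis for
   s applies. *)
pose f' j := if j == i then \1_B else f j.
pose e' j := if j == i then fine (P (X i @^-1` B)) else e j.
have eE : ((\prod_(j | j != i) e j)%:E * P (X i @^-1` B) = (\prod_j e' j)%:E)%E.
  rewrite [in RHS](bigD1 i)//= {1}/e' eqxx EFinM fineK; last first.
    by apply: fin_num_measure; exact: mXB.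
  rewrite muleC; congr (_ * _%:E)%E.
  by apply: eq_bigr => j /negbTE ji; rewrite /e' ji.
have fE w : h w * \1_B (X i w) = \prod_j f' j (X j w).
  rewrite [in RHS](bigD1 i)//= {1}/f' eqxx mulrC; congr (_ * _).
  by apply: eq_bigr => j /negbTE ji; rewrite /f' ji.
transitivity (\int[P]_w (\prod_j f' j (X j w))%:E)%E.
  by apply: eq_integral => w _; rewrite fE.
rewrite eE; apply: IH.
- by move=> j; rewrite /f'; case: ifP.
- by move=> j x; rewrite /f'; case: ifP => // _; rewrite indicE.
- move=> j; rewrite /f' /e'; case: ifPn => [/eqP ->|//].
  rewrite (integral_indic _ measurableT (mXB i B mB)) setIT fineK//.
  by apply: fin_num_measure; exact: mXB.
- move=> j js; rewrite /f'; case: ifPn => [_|ji]; first by exists B.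
  by apply: find; rewrite inE negb_or ji.
Qed.

End Independence.

(** * Gaussian integrals and bounds on cosh *)

Section GaussianIntegrals.
Variable R : realType.
Local Notation mu := (@lebesgue_measure R).
Implicit Types (s x l : R).

Lemma normal_pdf01E x :
  normal_pdf 0 1 x = normal_peak 1 * expR (- (x ^+ 2 / 2)) :> R.
Proof.
rewrite normal_pdfE ?oner_neq0// /normal_fun subr0 expr1n.
by rewrite mulr2n mulNr.
Qed.

(** Completing the square turns the integrand into a constant times the normal density of mean s. *)
Lemma integral_expR_normal s :
  (\int[mu]_x (expR (s * x) * normal_pdf 0 1 x)%:E = (expR (s ^+ 2 / 2))%:E)%E.
Proof.
transitivity (\int[mu]_x ((expR (s ^+ 2 / 2))%:E * (normal_pdf s 1 x)%:E))%E.
  apply: eq_integral => x _; rewrite -EFinM normal_pdf01E; congr EFin.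
  rewrite normal_pdfE ?oner_neq0// /normal_fun mulrCA -expRD.
  rewrite [RHS]mulrCA -expRD expr1n mulr2n; congr (_ * expR _).
  by rewrite mulNr; field.
rewrite ge0_integralZl//; first by rewrite integral_normal_pdf mule1.
- by apply/measurable_EFinP; exact: measurable_normal_pdf.
- by move=> x _; rewrite lee_fin normal_pdf_ge0.
Qed.

(** The integrand is 1 / v times the centred normal density of standard deviation 1 / v, where v^2 =
    1 - 2 l. *)
Lemma integral_expR_sqr_normal l : l < 2^-1 ->
  (\int[mu]_x (expR (l * x ^+ 2) * normal_pdf 0 1 x)%:E =
   ((Num.sqrt (1 - 2 * l))^-1)%:E)%E.
Proof.
move=> l2; have l0 : 0 < 1 - 2 * l by lra.
pose v := Num.sqrt (1 - 2 * l).
have v0 : 0 < v by rewrite sqrtr_gt0.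
have v2 : v ^+ 2 = 1 - 2 * l by rewrite sqr_sqrtr// ltW.
transitivity (\int[mu]_x ((v^-1)%:E * (normal_pdf 0 v^-1 x)%:E))%E.
  apply: eq_integral => x _; rewrite -EFinM normal_pdf01E; congr EFin.
  rewrite normal_pdfE ?invr_eq0 ?gt_eqF// /normal_fun subr0 mulrCA -expRD [RHS]mulrA.
  congr (_ * expR _); last first.
    rewrite exprVn v2 mulr2n mulNr; field.
    by rewrite gt_eqF.
  rewrite /normal_peak expr1n mul1r -mulrnAr exprVn sqrtrM ?invr_ge0 ?sqr_ge0//.
  by rewrite sqrtrV ?sqr_ge0// sqrtr_sqr gtr0_norm// invfM invrK mulKf ?gt_eqF.
rewrite ge0_integralZl//.
- by rewrite integral_normal_pdf mule1.
- by apply/measurable_EFinP; exact: measurable_normal_pdf.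
- by move=> x _; rewrite lee_fin normal_pdf_ge0.
- by rewrite lee_fin invr_ge0 ltW.
Qed.

End GaussianIntegrals.

Section Cosh.
Variable R : realType.
Implicit Types s : R.
Local Notation evens s n := (\sum_(k < n) s ^+ k.*2 / (k.*2)`!%:R).

(** The exponential series at s and at -s, cut at [n.*2], have equal even terms and opposite odd
    terms. *)
Lemma cvg_cosh s :
  evens s n @[n --> \oo] --> ((expR s + expR (- s)) / 2).
Proof.
have dbl : (n.*2 @[n --> \oo] --> \oo)%N.
  apply/cvgnyPge => A; near=> n.
  apply: (@leq_trans n); last by rewrite -addnn leq_addr.
  by near: n; exact: nbhs_infty_ge.
rewrite (_ : (fun n => _) = fun n =>
  (series (exp_coeff s) n.*2 + series (exp_coeff (- s)) n.*2) / 2).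
  apply: cvgMl; apply: cvgD.
    exact: (cvg_comp _ _ dbl (is_cvg_series_exp_coeff s)).
  exact: (cvg_comp _ _ dbl (is_cvg_series_exp_coeff (- s))).
apply/funext; elim => [|n IH].
  by rewrite big_ord0 /series/= !big_geq// addr0 mul0r.
rewrite big_ord_recr/= IH doubleS /series/= !big_nat_recr//=.
have ev : (- s) ^+ n.*2 = s ^+ n.*2 by rewrite -mul2n !exprM sqrrN.
rewrite /exp_coeff/= !exprS ev.
set a := (n.*2)`!%:R; set b := (n.*2).+1`!%:R; lra.
Unshelve. all: by end_near. Qed.

(** Term by term comparison of the even series with the exponential series at s^2 / 2, which amounts
    to 2^k k! <= (2k)!. *)
Lemma cosh_le s : (expR s + expR (- s)) / 2 <= expR (s ^+ 2 / 2).
Proof.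
have cvgE : series (exp_coeff (s ^+ 2 / 2)) n @[n --> \oo] --> expR (s ^+ 2 / 2).
  exact: is_cvg_series_exp_coeff.
apply: ler_cvg_to (@cvg_cosh s) cvgE _.
apply: nearW => n; rewrite /series/= big_mkord; apply: ler_sum => k _.
rewrite /exp_coeff/= expr_div_n -exprM mul2n -mulrA ler_wpM2l//.
  by rewrite -muln2 exprM sqr_ge0.
rewrite -invfM lef_pV2 ?posrE ?mulr_gt0 ?exprn_gt0 ?ltr0n ?fact_gt0//.
rewrite -natrX -natrM ler_nat.
elim: (nat_of_ord k) => // {}k IH.
rewrite doubleS !factS expnS mulnACA mul2n doubleS leq_mul//.
by rewrite (leq_trans IH)// leq_pmull.
Qed.

Lemma cosh_ge s : 1 + s ^+ 2 / 2 <= (expR s + expR (- s)) / 2.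
Proof.
apply: cvgr_to_ge (@cvg_cosh s) _; near=> n.
have -> : n = (n - 2).+2 by rewrite -addn2 subnK//; near: n; exact: nbhs_infty_ge.
rewrite !big_ord_recl/= expr0 divr1 addrA lerDl sumr_ge0// => k _.
by rewrite divr_ge0// -muln2 exprM sqr_ge0.
Unshelve. all: by end_near. Qed.

End Cosh.

(** * Moment generating functions of entries and rows *)

Section Entries.
Variables (R : realType) (disp : measure_display) (T : measurableType disp).
Variable P : probability T R.

(** Two uses of [ge0_integral_transfer]: from P to the law of X with weight 1, and from that law to
    Lebesgue measure with the density as weight. *)
Lemma mgf_gaussian (X : T -> R) (s : R) :
  measurable_fun setT X ->
  (forall B : set R, measurable B -> P [set w | B (X w)] = normal_prob 0 1 B) ->
  (\int[P]_w (expR (s * X w))%:E = (expR (s ^+ 2 / 2))%:E)%E.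
Proof.
move=> mX XN; rewrite -integral_expR_normal.
have mexp : measurable_fun setT (fun x : R => expR (s * x)).
  by apply: measurableT_comp => //; exact: measurable_funM.
transitivity (\int[normal_prob 0 1]_x (expR (s * x))%:E)%E.
  transitivity (\int[P]_w (1 * expR (s * X w))%:E)%E.
    by apply: eq_integral => w _; rewrite mul1r.
  rewrite -[RHS]mul1e.
  apply: (@ge0_integral_transfer _ _ _ _ _ P (normal_prob 0 1) X (cst 1) 1) => //.
  - move=> B mB; rewrite mul1e; apply: etrans (XN B mB).
    under eq_integral do rewrite mul1r.
    have mXB : measurable (X @^-1` B) by rewrite -(setTI (X @^-1` _)); exact: mX.
    by rewrite (integral_indic _ measurableT mXB) setIT.
transitivity (\int[lebesgue_measure]_x (normal_pdf 0 1 x * expR (s * x))%:E)%E.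
  apply/esym; rewrite -[RHS]mul1e.
  apply: (@ge0_integral_transfer _ _ _ _ _ (@lebesgue_measure R)
    (normal_prob 0 1) id (normal_pdf 0 1) 1) => //.
  - exact: measurable_normal_pdf.
  - by move=> x; exact: normal_pdf_ge0.
  - move=> B mB; rewrite mul1e.
    transitivity (\int[lebesgue_measure]_(x in B) (normal_pdf 0 1 x)%:E)%E => //.
    rewrite [in RHS]integral_mkcond.
    apply: eq_integral => x _; rewrite patchE indicE.
    by case: ifPn => _; rewrite ?mulr1 ?mulr0.
by apply: eq_integral => x _; rewrite mulrC.
Qed.

(** The two atoms have total mass 1, so the integrand is almost everywhere a combination of their
    indicators. *)
Lemma mgf_rademacher (X : T -> R) (s : R) :
  measurable_fun setT X ->
  P [set w | X w = 1] = (2^-1)%:E -> P [set w | X w = -1] = (2^-1)%:E ->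
  (\int[P]_w (expR (s * X w))%:E = ((expR s + expR (- s)) / 2)%:E)%E.
Proof.
move=> mX X1 XN1.
set A := [set w | X w = 1] in X1; set B := [set w | X w = -1] in XN1.
have mA : measurable A by rewrite -[A]setTI; exact: (mX measurableT [set 1]).
have mB : measurable B by rewrite -[B]setTI; exact: (mX measurableT [set -1]).
have AB : A `&` B = set0.
  rewrite -subset0 => w [wA wB].
  by have := etrans (esym (wA : X w = 1)) (wB : X w = -1); lra.
have PAB : P (~` (A `|` B)) = 0%E.
  rewrite probability_setC; last exact: measurableU.
  have -> : (P (A `|` B) = P A + P B)%E by rewrite measureU.
  have half : 2^-1 + 2^-1 = 1 :> R by lra.
  by rewrite X1 XN1 -EFinD half subrr.
transitivity (\int[P]_w (expR s * \1_A w + expR (- s) * \1_B w)%:E)%E.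
  apply: ae_eq_integral => //.
  - apply/measurable_EFinP; apply: measurableT_comp => //.
    exact: measurable_funM.
  - apply/measurable_EFinP; apply: measurable_funD; exact: measurable_funM.
  exists (~` (A `|` B)); split => //; first by apply: measurableC; exact: measurableU.
  apply: subsetC => w wAB _; congr EFin; rewrite !indicE.
  case: wAB => wX.
    rewrite mem_set// memNset; last first.
      by move=> wB; have : (A `&` B) w by []; rewrite AB.
    by rewrite (wX : X w = 1) !mulr1 mulr0 addr0.
  rewrite memNset; last by move=> wA; have : (A `&` B) w by []; rewrite AB.
  by rewrite mem_set// (wX : X w = -1) mulrN !mulr1 mulr0 add0r.
under eq_integral do rewrite EFinD !EFinM.
rewrite ge0_integralD//; try by apply: measurable_funeM; exact/measurable_EFinP.
rewrite !ge0_integralZl//; try exact/measurable_EFinP.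
have -> : (\int[P]_w (\1_A w)%:E = (2^-1)%:E)%E.
  by rewrite integral_indic// setIT; exact: X1.
have -> : (\int[P]_w (\1_B w)%:E = (2^-1)%:E)%E.
  by rewrite integral_indic// setIT; exact: XN1.
by rewrite -!EFinM -EFinD; congr EFin; lra.
Qed.

(** The total exponent is the sum of [s i * v j 0 * X w i j] over all entries, so independence of
    the family indexed by pairs applies. *)
Lemma mgf_rows (m d : nat) (X : T -> 'M[R]_(m, d)) (psi : R -> R) :
  random_matrix X -> independent_entries P X ->
  (forall i j s, (\int[P]_w (expR (s * X w i j))%:E = (psi s)%:E)%E) ->
  forall (v : 'cV[R]_d) (s : 'I_m -> R),
  (\int[P]_w (\prod_i expR (s i * (X w *m v) i 0))%:E =
   (\prod_i \prod_j psi (s i * v j 0))%:E)%E.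
Proof.
move=> mX indep psiE v s.
pose Z (ij : 'I_m * 'I_d) w := X w ij.1 ij.2.
have mZ ij : measurable_fun setT (Z ij) by exact: mX.
have indepZ (B : 'I_m * 'I_d -> set R) : (forall ij, measurable (B ij)) ->
    (P [set w | forall ij, B ij (Z ij w)] =
     \prod_ij P [set w | B ij (Z ij w)])%E.
  move=> mB; have := indep (fun i j => B (i, j)) (fun i j => mB (i, j)).
  rewrite pair_bigA/= => e; rewrite (_ : [set w | _] =
    [set w | forall i j, B (i, j) (X w i j)]).
    by rewrite e; apply: eq_bigr => -[i j] _.
  by apply/seteqP; split => w wB; [move=> i j; exact: wB | case=> i j; exact: wB].
rewrite pair_bigA/=.
rewrite -(@integral_prod_indep _ _ _ _ _ _ mZ indepZ
  (fun ij x => expR (s ij.1 * v ij.2 0 * x))).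
- apply: eq_integral => w _; congr EFin.
  transitivity (\prod_i \prod_j expR (s i * v j 0 * Z (i, j) w)); last first.
    by rewrite pair_bigA/=; apply: eq_bigr => -[i j].
  apply: eq_bigr => i _; rewrite -expR_sum mxE mulr_sumr; congr expR.
  by apply: eq_bigr => j _; rewrite /Z/=; ring.
- move=> ij; apply: measurableT_comp => //; exact: measurable_funM.
- by move=> ij x; exact: expR_ge0.
- by move=> ij; rewrite psiE.
Qed.

End Entries.

(** * Elementary exponential inequalities *)

Section ExpBounds.
Variable R : realType.
Implicit Types x : R.

(** Multiply by 1 - x: on the left (1 - x) exp x <= 1, on the right 1 + x^2 (1 - 2x) >= 1. *)
Lemma expR_le_quad x : 0 <= x -> x <= 2^-1 -> expR x <= 1 + x + 2 * x ^+ 2.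
Proof.
move=> x0 x2.
have hq : 1 <= (1 - x) * (1 + x + 2 * x ^+ 2).
  have -> : (1 - x) * (1 + x + 2 * x ^+ 2) = 1 + x ^+ 2 * (1 - 2 * x) by ring.
  by rewrite lerDl mulr_ge0 ?sqr_ge0//; lra.
have h : 0 < 1 - x by lra.
rewrite -(ler_pM2l h) (le_trans _ hq)//.
have e1 : expR (- x) * expR x = 1 by rewrite -expRD addNr expR0.
by rewrite -[leRHS]e1 ler_pM2r ?expR_gt0// expR_ge1Dx.
Qed.

(** After squaring, 1 / (1 - 2x) = 1 + y <= exp y for y = 2x / (1 - 2x), and y <= 2x + 8x^2 when x
    <= 1/4. *)
Lemma invsqrt_le x : 0 <= x -> x <= 4^-1 ->
  (Num.sqrt (1 - 2 * x))^-1 <= expR (x + 4 * x ^+ 2).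
Proof.
move=> x0 x4; have y0 : 0 < 1 - 2 * x by lra.
rewrite -(@ler_pXn2r _ 2)// ?nnegrE ?invr_ge0 ?sqrtr_ge0 ?expR_ge0//.
rewrite exprVn sqr_sqrtr ?(ltW y0)//.
have -> : expR (x + 4 * x ^+ 2) ^+ 2 = expR (2 * x + 8 * x ^+ 2).
  by rewrite [LHS]expr2 -expRD; congr expR; ring.
apply: (@le_trans _ _ (1 + (2 * x) / (1 - 2 * x))).
  rewrite le_eqVlt; apply/orP; left; apply/eqP.
  by field; rewrite gt_eqF.
apply: (le_trans (expR_ge1Dx _)); rewrite ler_expR.
rewrite ler_pdivrMr//.
have : x ^+ 2 * (1 - 4 * x) >= 0 by rewrite mulr_ge0 ?sqr_ge0//; lra.
rewrite !expr2; nra.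
Qed.

(* [cosh z <= expR (z ^+ 2 / 2)] gives [expR (- z ^+ 2) <= (1 + s)^-2] for
   [s = cosh z - 1], and [(1 + s)^-2 <= 1 - 2 s + 3 s ^+ 2], which is a linear
   combination of exponentials of multiples of z. *)
Lemma expR_sqr_le_expsum z :
  expR (- z ^+ 2) <= 15 / 2 - 4 * (expR z + expR (- z))
    + 3 / 4 * (expR (2 * z) + expR (- (2 * z))) :> R.
Proof.
set a := expR z; set b := expR (- z).
have a0 : 0 < a by exact: expR_gt0.
have b0 : 0 < b by exact: expR_gt0.
have ab : a * b = 1 by rewrite -expRD subrr expR0.
have -> : expR (2 * z) = a ^+ 2 by rewrite expr2 -expRD; congr expR; ring.
have -> : expR (- (2 * z)) = b ^+ 2 by rewrite expr2 -expRD; congr expR; ring.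
pose s := (a + b) / 2 - 1.
have s0 : 0 <= s by have := sqr_ge0 (a - b); rewrite /s; nra.
have -> : 15 / 2 - 4 * (a + b) + 3 / 4 * (a ^+ 2 + b ^+ 2) =
    1 - 2 * s + 3 * s ^+ 2.
  have -> : a ^+ 2 + b ^+ 2 = (a + b) ^+ 2 - 2 * (a * b) by ring.
  by rewrite ab /s; field.
have sz : (1 + s) ^+ 2 <= expR (z ^+ 2).
  have -> : expR (z ^+ 2) = expR (z ^+ 2 / 2) ^+ 2.
    by rewrite [RHS]expr2 -expRD; congr expR; field.
  rewrite ler_pXn2r ?nnegrE ?expR_ge0//; last by lra.
  by apply: le_trans (cosh_le z); rewrite /s -/a -/b; lra.
rewrite expRN; apply: (@le_trans _ _ ((1 + s) ^+ 2)^-1).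
  by rewrite lef_pV2 ?posrE ?expR_gt0 ?exprn_gt0//; lra.
rewrite -[X in X <= _]mul1r ler_pdivrMr ?exprn_gt0//; last by lra.
have -> : (1 - 2 * s + 3 * s ^+ 2) * (1 + s) ^+ 2 = 1 + s ^+ 3 * (4 + 3 * s).
  by ring.
by rewrite lerDl mulr_ge0 ?exprn_ge0//; lra.
Qed.

End ExpBounds.

Section LevelSets.
Variables (R : realType) (disp : measure_display) (T : measurableType disp).
Variable f : T -> R.
Hypothesis mf : measurable_fun setT f.

Lemma measurable_superlevel (c : R) : measurable [set w | c <= f w].
Proof.
rewrite [X in measurable X](_ : _ = f @^-1` `[c, +oo[).
  by rewrite -[X in measurable X]setTI; apply: mf.
by apply/seteqP; split => w /=; rewrite in_itv/= andbT.
Qed.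

Lemma measurable_sublevel (c : R) : measurable [set w | f w <= c].
Proof.
rewrite [X in measurable X](_ : _ = f @^-1` `]-oo, c]).
  by rewrite -[X in measurable X]setTI; apply: mf.
by apply/seteqP; split => w /=; rewrite in_itv.
Qed.

End LevelSets.

(** * Tail bounds for a sum of squares *)

Section Concentration.
Variables (R : realType) (disp : measure_display) (T : measurableType disp).
Variables (P : probability T R) (m : nat) (Y : 'I_m -> T -> R) (mgf : R -> R).
Hypothesis mY : forall i, measurable_fun setT (Y i).
Hypothesis YE : forall s : 'I_m -> R,
  (\int[P]_w (\prod_i expR (s i * Y i w))%:E = (\prod_i mgf (s i))%:E)%E.
Hypothesis mgf_le : forall s, mgf s <= expR (s ^+ 2 / 2).
Hypothesis mgf_ge : forall s, 1 + s ^+ 2 / 2 <= mgf s.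

Lemma probability_le_integral (A : set T) (g : T -> R) : measurable A ->
  measurable_fun setT g -> (forall w, 0 <= g w) -> (forall w, A w -> 1 <= g w) ->
  (P A <= \int[P]_w (g w)%:E)%E.
Proof.
move=> mA mg g0 g1.
have -> : P A = (\int[P]_w (\1_A w)%:E)%E by rewrite integral_indic// setIT.
apply: ge0_le_integral => //.
- exact/measurable_EFinP.
- exact/measurable_EFinP.
- move=> w _; rewrite lee_fin indicE.
  by case: (boolP (w \in A)) => [/set_mem/g1|].
Qed.

(* Rows are treated one at a time: [expR (l * y ^+ 2)] is the average of
   [expR (sqrt (2 * l) * t * y)] over a standard Gaussian t. *)
Lemma integral_expR_sqr_le (l : R) (k : nat) : 0 <= l -> l < 2^-1 -> (k <= m)%N ->
  forall s : 'I_m -> R,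
  (\int[P]_w (\prod_(i < m) (if (i < k)%N then expR (l * Y i w ^+ 2)
                            else expR (s i * Y i w)))%:E <=
   (\prod_(i < m) (if (i < k)%N then (Num.sqrt (1 - 2 * l))^-1
                   else expR (s i ^+ 2 / 2)))%:E)%E.
Proof.
move=> l0 l2.
have mexp i s : measurable_fun setT (fun w => expR (s * Y i w)).
  by apply: measurableT_comp => //; exact: measurable_funM.
have msq i : measurable_fun setT (fun w => expR (l * Y i w ^+ 2)).
  apply: measurableT_comp => //; apply: measurable_funM => //.
  exact: measurable_funX.
elim: k => [_ s|k IH km s].
  rewrite YE lee_fin; apply: ler_prod => i _; rewrite mgf_le andbT.
  by apply: le_trans (mgf_ge _); rewrite addr_ge0// divr_ge0// sqr_ge0.
pose i0 := Ordinal km; pose r := Num.sqrt (2 * l).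
have r2 : r ^+ 2 = 2 * l by rewrite sqr_sqrtr// mulr_ge0.
pose h w := \prod_(i < m | i != i0) (if (i < k)%N then expR (l * Y i w ^+ 2)
  else expR (s i * Y i w)).
pose b := \prod_(i < m | i != i0) (if (i < k)%N then (Num.sqrt (1 - 2 * l))^-1
  else expR (s i ^+ 2 / 2)).
have h0 w : 0 <= h w by apply: prodr_ge0 => i _; case: ifP; rewrite expR_ge0.
have b0 : 0 <= b.
  by apply: prodr_ge0 => i _; case: ifP; rewrite ?expR_ge0 ?invr_ge0 ?sqrtr_ge0.
have mh : measurable_fun setT h.
  rewrite /h; under eq_fun do rewrite -big_filter.
  by apply: measurable_prod => i _; case: (i < k)%N.
have other i : i != i0 -> (i < k.+1)%N = (i < k)%N.
  by rewrite -val_eqE/= ltnS leq_eqVlt => /negbTE ->.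
rewrite (bigD1 i0)//= ltnSn.
rewrite (eq_bigr (fun i : 'I_m => if (i < k)%N then (Num.sqrt (1 - 2 * l))^-1
  else expR (s i ^+ 2 / 2))); last by move=> i /other ->.
rewrite -/b.
have mphi : measurable_fun [set: R] (normal_pdf 0 1 : R -> R).
  exact: measurable_normal_pdf.
have phi0 (t : R) : 0 <= normal_pdf 0 1 t :> R by exact: normal_pdf_ge0.
(* Integrating [F] over t restores [expR (l * Y i0 w ^+ 2)], because [r ^+ 2 = 2 * l]; Tonelli then
   lets P be integrated first. *)
pose F (wt : T * R) : \bar R :=
  (h wt.1 * expR (r * wt.2 * Y i0 wt.1) * normal_pdf 0 1 wt.2)%:E.
have mF : measurable_fun setT F.
  apply/measurable_EFinP; apply: measurable_funM; last first.
    exact: (measurableT_comp mphi measurable_snd).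
  apply: measurable_funM; first exact: (measurableT_comp mh measurable_fst).
  apply: measurableT_comp => //; apply: measurable_funM.
    by apply: measurable_funM => //; exact: measurable_snd.
  exact: (measurableT_comp (mY i0) measurable_fst).
have F0 wt : (0 <= F wt)%E by rewrite lee_fin !mulr_ge0 ?expR_ge0.
have -> : (\int[P]_w (\prod_(i < m) (if (i < k.+1)%N then expR (l * Y i w ^+ 2)
      else expR (s i * Y i w)))%:E =
    \int[P]_w \int[lebesgue_measure]_t F (w, t))%E.
  apply: eq_integral => w _; rewrite (bigD1 i0)//= ltnSn.
  rewrite (eq_bigr (fun i : 'I_m => if (i < k)%N then expR (l * Y i w ^+ 2)
    else expR (s i * Y i w))); last by move=> i /other ->.
  rewrite -/(h w).
  transitivity (\int[lebesgue_measure]_t ((h w)%:E *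
    (expR (r * Y i0 w * t) * normal_pdf 0 1 t)%:E))%E; last first.
    apply: eq_integral => t _; rewrite /F/= -EFinM mulrA.
    by rewrite -!mulrA (mulrC t).
  rewrite ge0_integralZl//.
  - rewrite integral_expR_normal -EFinM mulrC; congr (_ * expR _)%:E.
    by rewrite exprMn r2; field.
  - apply/measurable_EFinP; apply: measurable_funM => //.
    by apply: measurableT_comp => //; exact: measurable_funM.
  - by move=> t _; rewrite lee_fin mulr_ge0 ?expR_ge0.
  - by rewrite lee_fin.
have -> : (\int[P]_w \int[lebesgue_measure]_t F (w, t) =
    \int[lebesgue_measure]_t \int[P]_w F (w, t))%E.
  exact: fubini_tonelli.
apply: (@le_trans _ _ (\int[lebesgue_measure]_t
    (b%:E * (expR (l * t ^+ 2) * normal_pdf 0 1 t)%:E))%E); last first.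
  rewrite ge0_integralZl//.
  - by rewrite integral_expR_sqr_normal// -EFinM mulrC.
  - apply/measurable_EFinP; apply: measurable_funM => //.
    apply: measurableT_comp => //; apply: measurable_funM => //.
  - by move=> t _; rewrite lee_fin mulr_ge0 ?expR_ge0.
apply: ge0_le_integral => //.
- by move=> t _; exact: integral_ge0.
- exact: measurable_fun_fubini_tonelli_G.
- apply: measurable_funeM; apply/measurable_EFinP; apply: measurable_funM => //.
  apply: measurableT_comp => //; apply: measurable_funM => //.
move=> t _; rewrite /F/=.
under eq_integral do rewrite mulrC EFinM.
rewrite ge0_integralZl//; last 3 first.
- by apply/measurable_EFinP; exact: measurable_funM.
- by move=> w _; rewrite lee_fin mulr_ge0 ?expR_ge0.
- by rewrite lee_fin.
rewrite -EFinM mulrA (mulrC _ (normal_pdf _ _ _)) EFinM lee_wpmul2l//.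
  by rewrite lee_fin.
(* For fixed t, row k carries an exponential of parameter [r * t], which the induction hypothesis
   accepts as the value of [s i0]. *)
have := IH (ltnW km) (fun i => if i == i0 then r * t else s i).
rewrite [in X in (_ <= X)%E](bigD1 i0)//= ltnn eqxx.
rewrite (eq_bigr (fun i : 'I_m => if (i < k)%N then (Num.sqrt (1 - 2 * l))^-1
  else expR (s i ^+ 2 / 2))); last by move=> i /negbTE ->.
rewrite -/b (_ : (r * t) ^+ 2 / 2 = l * t ^+ 2); last first.
  by rewrite exprMn r2; field.
move=> IHt; rewrite [b * _]mulrC; apply: le_trans IHt; rewrite le_eqVlt; apply/orP; left; apply/eqP.
apply: eq_integral => w _; congr EFin; rewrite (bigD1 i0)//= ltnn eqxx mulrC.
by congr (_ * _); apply: eq_bigr => i /negbTE ->.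
Qed.

Lemma upper_tail (tau : R) : 0 <= tau -> tau <= 1 ->
  (P [set w | (m%:R * (1 + tau) <= \sum_i Y i w ^+ 2)%R] <=
   (expR (- (m%:R * (tau ^+ 2 / 16))))%:E)%E.
Proof.
(* tau / 8 minimises - l tau + 4 l^2, the exponent per row obtained from the exponential Markov
   inequality and [invsqrt_le]. *)
move=> t0 t1; pose l := tau / 8.
have l0 : 0 <= l by rewrite /l; lra.
have mS : measurable_fun setT (fun w => \sum_i Y i w ^+ 2).
  by apply: measurable_sum => i; exact: measurable_funX.
have mA : measurable [set w | m%:R * (1 + tau) <= \sum_i Y i w ^+ 2].
  exact: measurable_superlevel.
have hl : (l < 2^-1) by rewrite /l; lra.
have := integral_expR_sqr_le l0 hl (leqnn m) (fun=> 0).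
under eq_integral do under eq_bigr do rewrite ltn_ord.
under eq_bigr do rewrite ltn_ord.
rewrite prodr_const card_ord => H.
pose c := expR (- (l * (m%:R * (1 + tau)))).
have mprod : measurable_fun setT (fun w => \prod_i expR (l * Y i w ^+ 2)).
  apply: measurable_prod => i _; apply: measurableT_comp => //.
  by apply: measurable_funM => //; exact: measurable_funX.
apply: le_trans (@probability_le_integral _
    (fun w => c * \prod_i expR (l * Y i w ^+ 2)) mA _ _ _) _.
- exact: measurable_funM.
- by move=> w; rewrite mulr_ge0 ?expR_ge0 ?prodr_ge0// => i _; exact: expR_ge0.
- move=> w /= Aw; rewrite -expR_sum -mulr_sumr -expRD -[X in X <= _]expR0.
  by rewrite ler_expR addrC subr_ge0 ler_wpM2l.
under eq_integral do rewrite EFinM.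
rewrite ge0_integralZl//; last 3 first.
- exact/measurable_EFinP.
- by move=> w _; rewrite lee_fin prodr_ge0// => i _; rewrite ?expR_ge0.
- by rewrite lee_fin expR_ge0.
apply: (@le_trans _ _ (c%:E * ((Num.sqrt (1 - 2 * l))^-1 ^+ m)%:E)%E).
  by rewrite lee_wpmul2l// lee_fin expR_ge0.
rewrite -EFinM lee_fin.
apply: (@le_trans _ _ (c * expR (l + 4 * l ^+ 2) ^+ m)).
  rewrite ler_wpM2l ?expR_ge0// lerXn2r ?nnegrE ?invr_ge0 ?sqrtr_ge0 ?expR_ge0//.
  by apply: invsqrt_le => //; rewrite /l; lra.
rewrite -expRM_natl -expRD ler_expR -subr_ge0 le_eqVlt; apply/orP; left.
by apply/eqP; rewrite /l; field.
Qed.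

Lemma lower_tail (tau : R) : 0 <= tau -> tau <= 1 ->
  (P [set w | (\sum_i Y i w ^+ 2 <= m%:R * (1 - tau))%R] <=
   (expR (- (m%:R * (tau ^+ 2 / 48))))%:E)%E.
Proof.
(* tau / 24 minimises - l tau + 12 l^2, the exponent per row obtained with [EGle] below. *)
move=> t0 t1; pose l := tau / 24.
have l0 : 0 <= l by rewrite /l; lra.
have l24 : l <= 24^-1 by rewrite /l; lra.
pose t := Num.sqrt l.
have t2 : t ^+ 2 = l by rewrite sqr_sqrtr.
have mS : measurable_fun setT (fun w => \sum_i Y i w ^+ 2).
  by apply: measurable_sum => i; exact: measurable_funX.
have mA : measurable [set w | \sum_i Y i w ^+ 2 <= m%:R * (1 - tau)].
  exact: measurable_sublevel.
(* Coefficients and exponents of [expR_sqr_le_expsum] at z = t * y. *)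
pose a (k : 'I_5) : R := [:: 3 / 4; - 4; 15 / 2; - 4; 3 / 4]`_k.
pose e (k : 'I_5) : R := [:: - (2 * t); - t; 0; t; 2 * t]`_k.
pose G (y : R) := \sum_k a k * expR (e k * y).
pose EG := \sum_k a k * mgf (e k).
have G_ge y : expR (- (l * y ^+ 2)) <= G y.
  rewrite /G !big_ord_recl big_ord0 /a /e/=.
  have := expR_sqr_le_expsum (t * y); rewrite exprMn t2.
  by rewrite !mulNr mul0r expR0 (mulrA 2 t y); lra.
have EG0 : 0 <= EG.
  rewrite /EG !big_ord_recl big_ord0 /a /e/=.
  have := mgf_le t; have := mgf_le (- t); have := mgf_ge (2 * t).
  have := mgf_ge (- (2 * t)); have := mgf_ge 0.
  rewrite !sqrrN expr0n/= mul0r exprMn t2.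
  have := @expR_le_quad _ (l / 2); set E := expR _ => hE.
  have : E <= 1 + l / 2 + 2 * (l / 2) ^+ 2 by apply: hE; lra.
  rewrite !expr2; nra.
(* The coefficients -4 call for [mgf_ge], the others for [mgf_le]: EG <= 15/2 - 8 (1 + l/2) + 3/2 (1
   + 2l + 8 l^2) = 1 - l + 12 l^2. *)
have EGle : EG <= expR (- l + 12 * l ^+ 2).
  apply: le_trans (expR_ge1Dx _).
  rewrite /EG !big_ord_recl big_ord0 /a /e/=.
  have := mgf_ge t; have := mgf_ge (- t); have := mgf_le (2 * t).
  have := mgf_le (- (2 * t)); have := mgf_le 0.
  rewrite !sqrrN expr0n/= mul0r expR0 exprMn t2.
  have := @expR_le_quad _ (2 ^+ 2 * l / 2); set E := expR _ => hE.
  have : E <= 1 + 2 ^+ 2 * l / 2 + 2 * (2 ^+ 2 * l / 2) ^+ 2 by apply: hE; lra.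
  rewrite !expr2; nra.
(* The product of sums is expanded over all choices f of one exponential per row; as the
   coefficients have mixed signs, linearity is applied to integrable functions. *)
have YG : (\int[P]_w (\prod_i G (Y i w))%:E = (EG ^+ m)%:E)%E.
  have distr (F : 'I_m -> 'I_5 -> R) : \prod_i \sum_k a k * F i k =
      \sum_(f : {ffun 'I_m -> 'I_5}) (\prod_i a (f i)) * \prod_i F i (f i).
    rewrite bigA_distr_bigA/=; apply: eq_bigr => f _.
    by rewrite big_split.
  transitivity (\int[P]_w (\sum_(f : {ffun 'I_m -> 'I_5})
      (\prod_i a (f i))%:E * (\prod_i expR (e (f i) * Y i w))%:E))%E.
    apply: eq_integral => w _; rewrite distr -sumEFin.
    by apply: eq_bigr => f _; rewrite EFinM.
  have mexps (f : {ffun 'I_m -> 'I_5}) :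
      measurable_fun setT (fun w => \prod_i expR (e (f i) * Y i w)).
    apply: measurable_prod => i _; apply: measurableT_comp => //.
    exact: measurable_funM.
  have intexp (f : {ffun 'I_m -> 'I_5}) : P.-integrable setT
      (fun w => (\prod_i expR (e (f i) * Y i w))%:E).
    apply/integrableP; split; first exact/measurable_EFinP.
    under eq_integral => w _.
      rewrite gee0_abs; last first.
        by rewrite lee_fin prodr_ge0// => i _; exact: expR_ge0.
      over.
    by rewrite YE ltry.
  rewrite integral_sum//; last by move=> f; exact: integrableZl.
  rewrite -[X in EG ^+ X]card_ord -prodr_const distr -sumEFin.
  apply: eq_bigr => f _.
  by rewrite integralZl// YE EFinM.
pose c := expR (l * (m%:R * (1 - tau))).
have G0 y : 0 <= G y by apply: le_trans (G_ge y); exact: expR_ge0.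
have mprod : measurable_fun setT (fun w => \prod_i G (Y i w)).
  apply: measurable_prod => i _; apply: measurable_sum => k.
  apply: measurable_funM => //; apply: measurableT_comp => //.
  exact: measurable_funM.
apply: le_trans (@probability_le_integral _
    (fun w => c * \prod_i G (Y i w)) mA _ _ _) _.
- exact: measurable_funM.
- by move=> w; rewrite mulr_ge0 ?expR_ge0 ?prodr_ge0.
- move=> w /= Aw.
  apply: (@le_trans _ _ (c * \prod_i expR (- (l * Y i w ^+ 2)))).
    rewrite -expR_sum sumrN -mulr_sumr -expRD -[X in X <= _]expR0.
    by rewrite ler_expR subr_ge0 ler_wpM2l.
  rewrite ler_wpM2l ?expR_ge0//; apply: ler_prod => i _.
  by rewrite expR_ge0 G_ge.
under eq_integral do rewrite EFinM.
rewrite ge0_integralZl//; last 3 first.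
- exact/measurable_EFinP.
- by move=> w _; rewrite lee_fin prodr_ge0.
- by rewrite lee_fin expR_ge0.
rewrite YG -EFinM lee_fin.
apply: (@le_trans _ _ (c * expR (- l + 12 * l ^+ 2) ^+ m)).
  by rewrite ler_wpM2l ?expR_ge0// lerXn2r ?nnegrE ?expR_ge0.
rewrite -expRM_natl -expRD ler_expR -subr_ge0 le_eqVlt; apply/orP; left.
by apply/eqP; rewrite /l; field.
Qed.

End Concentration.

(** * The Johnson-Lindenstrauss guarantee *)

Section JohnsonLindenstrauss.
Variables (R : realType) (disp : measure_display) (T : measurableType disp).
Variables (P : probability T R) (m d : nat) (X : T -> 'M[R]_(m, d)).
Variable psi : R -> R.
Hypotheses (mX : random_matrix X) (indepX : independent_entries P X).
Hypothesis psiE :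
  forall i j s, (\int[P]_w (expR (s * X w i j))%:E = (psi s)%:E)%E.
Hypothesis psi_le : forall s, psi s <= expR (s ^+ 2 / 2).
Hypothesis psi_ge : forall s, 1 + s ^+ 2 / 2 <= psi s.
Hypothesis m0 : (0 < m)%N.

(** Carries the lower bound on [psi] over to the product over the entries of a row. *)
Lemma prodr_1D_ge (I : Type) (r : seq I) (x : I -> R) : (forall i, 0 <= x i) ->
  1 + \sum_(i <- r) x i <= \prod_(i <- r) (1 + x i).
Proof.
move=> x0; elim: r => [|i r IH]; first by rewrite !big_nil addr0.
rewrite !big_cons; have S0 : 0 <= \sum_(j <- r) x j by exact: sumr_ge0.
have := x0 i; have : (1 + x i) * (1 + \sum_(j <- r) x j) <=
    (1 + x i) * \prod_(j <- r) (1 + x j).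
  by rewrite ler_wpM2l// addr_ge0.
nra.
Qed.

Lemma measurable_row (v : 'cV[R]_d) i :
  measurable_fun setT (fun w => (X w *m v) i 0).
Proof.
rewrite (_ : (fun w => _) = fun w => \sum_j X w i j * v j 0); last first.
  by apply/funext => w; rewrite mxE.
by apply: measurable_sum => j; exact: measurable_funM.
Qed.

Section UnitVector.
Variable u : 'cV[R]_d.
Hypothesis u1 : \sum_j u j 0 ^+ 2 = 1.

Lemma row_mgf_le s : \prod_j psi (s * u j 0) <= expR (s ^+ 2 / 2).
Proof.
apply: (@le_trans _ _ (\prod_j expR ((s * u j 0) ^+ 2 / 2))).
  apply: ler_prod => j _; rewrite psi_le andbT.
  by apply: le_trans (psi_ge _); rewrite addr_ge0// divr_ge0// sqr_ge0.
rewrite -expR_sum ler_expR -mulr_suml.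
under eq_bigr do rewrite exprMn.
by rewrite -mulr_sumr u1 mulr1.
Qed.

Lemma row_mgf_ge s : 1 + s ^+ 2 / 2 <= \prod_j psi (s * u j 0).
Proof.
apply: (@le_trans _ _ (\prod_j (1 + (s * u j 0) ^+ 2 / 2))); last first.
  apply: ler_prod => j _; rewrite psi_ge andbT.
  by rewrite addr_ge0// divr_ge0// sqr_ge0.
apply: le_trans (prodr_1D_ge _ _); last first.
  by move=> j; rewrite divr_ge0// sqr_ge0.
rewrite -mulr_suml; under [X in _ <= 1 + X / _]eq_bigr do rewrite exprMn.
by rewrite -mulr_sumr u1 mulr1.
Qed.

Lemma sqr_norm_concentration (tau : R) : 0 <= tau -> tau <= 1 ->
  exists A : set T, [/\ measurable A,
    A `<=` [set w | m%:R * (1 - tau) <= \sum_i (X w *m u) i 0 ^+ 2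
                                     <= m%:R * (1 + tau)] &
    (P (~` A) <= (2 * expR (- (m%:R * (tau ^+ 2 / 48))))%:E)%E].
Proof.
move=> t0 t1; pose Y i w := (X w *m u) i 0.
have YE (s : 'I_m -> R) : (\int[P]_w (\prod_i expR (s i * Y i w))%:E =
    (\prod_i \prod_j psi (s i * u j 0))%:E)%E by exact: mgf_rows.
have mS : measurable_fun setT (fun w => \sum_i Y i w ^+ 2).
  by apply: measurable_sum => i; apply: measurable_funX; exact: measurable_row.
pose U := [set w | m%:R * (1 + tau) <= \sum_i Y i w ^+ 2].
pose L := [set w | \sum_i Y i w ^+ 2 <= m%:R * (1 - tau)].
have mU : measurable U by exact: measurable_superlevel.
have mL : measurable L by exact: measurable_sublevel.
exists (~` (U `|` L)); split; first by apply: measurableC; exact: measurableU.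
  move=> w /= /not_orP[/negP]; rewrite -ltNge => hU /negP; rewrite -ltNge => hL.
  by rewrite !ltW.
rewrite setCK; apply: (le_trans (measureU2 _ mU mL)).
have -> : 2 * expR (- (m%:R * (tau ^+ 2 / 48))) =
  expR (- (m%:R * (tau ^+ 2 / 48))) + expR (- (m%:R * (tau ^+ 2 / 48))) by ring.
rewrite EFinD; apply: leeD; last first.
  exact: (lower_tail (fun i => measurable_row u i) YE row_mgf_le row_mgf_ge).
apply: le_trans (upper_tail (fun i => measurable_row u i) YE row_mgf_le row_mgf_ge
  t0 t1) _.
rewrite lee_fin ler_expR lerN2 ler_wpM2l// ler_wpM2l ?sqr_ge0//.
by rewrite lef_pV2 ?posrE// ler_nat.
Qed.

End UnitVector.

(** Concentration of the squared norm within tau = g / (2 + g) is enough: (1 + g/2)^2 (1 - tau) = 1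
    + g/2 >= 1, and (1 + g/2)^2 (1 + tau) = (1 + g/2)(1 + g) <= (1 + g)^2. *)
Lemma jl_vector (g : R) (v : 'cV[R]_d) : 0 < g ->
  exists A : set T, [/\ measurable A,
    A `<=` [set w | enorm v <= enorm ((jl_scale g m *: X w) *m v)
                            <= (1 + g) * enorm v] &
    (P (~` A) <= (2 * expR (- (m%:R * ((g / (2 + g)) ^+ 2 / 48))))%:E)%E].
Proof.
move=> g0; have [v0|v0] := eqVneq (enorm v) 0.
  exists setT; split => //; last by rewrite setCT measure0 lee_fin mulr_ge0 ?expR_ge0.
  have -> : v = 0.
    apply/colP => i; rewrite mxE; apply/eqP; rewrite -sqrf_eq0 eq_le sqr_ge0 andbT.
    have <- : enorm v ^+ 2 = 0 by rewrite v0 expr0n.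
    by rewrite enorm_sqr (bigD1 i)//= lerDl sumr_ge0// => j _; exact: sqr_ge0.
  move=> w _ /=; rewrite mulmx0.
  have enorm0 k : enorm (0 : 'cV[R]_k) = 0.
    by rewrite /enorm big1 ?sqrtr0// => i _; rewrite mxE expr0n.
  by rewrite !enorm0 mulr0 lexx.
have {}v0 : 0 < enorm v by rewrite lt_neqAle eq_sym v0 enorm_ge0.
pose u := (enorm v)^-1 *: v.
have vu : v = enorm v *: u by rewrite scalerA divff ?gt_eqF// scale1r.
have u1 : \sum_j u j 0 ^+ 2 = 1.
  rewrite -enorm_sqr enormZ ?invr_ge0 ?enorm_ge0// mulVf ?gt_eqF//.
  by rewrite expr1n.
pose tau := g / (2 + g).
have g2 : 0 < 2 + g by lra.
have tauE : tau * (2 + g) = g by rewrite divfK// gt_eqF.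
have tau0 : 0 <= tau by rewrite divr_ge0 ?ltW.
have tau1 : tau <= 1 by rewrite ler_pdivrMr//; lra.
have [A [mA AS PA]] := sqr_norm_concentration u1 tau0 tau1.
exists A; split => // w /AS/= /andP[SL SU].
have scale0 : 0 <= jl_scale g m by rewrite divr_ge0 ?sqrtr_ge0//; lra.
have -> : enorm (jl_scale g m *: X w *m v) =
    enorm v * (jl_scale g m * enorm (X w *m u)).
  by rewrite -scalemxAl enormZ// {1}vu -scalemxAr enormZ ?enorm_ge0// mulrCA.
suff /andP[qL qU] : 1 <= jl_scale g m * enorm (X w *m u) <= 1 + g.
  by rewrite ler_peMr ?enorm_ge0//= [(1 + g) * _]mulrC ler_pM2l.
have mR : 0 < m%:R :> R by rewrite ltr0n.
have sq : (jl_scale g m * enorm (X w *m u)) ^+ 2 * m%:R =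
    (1 + g / 2) ^+ 2 * \sum_i (X w *m u) i 0 ^+ 2.
  rewrite exprMn enorm_sqr /jl_scale expr_div_n sqr_sqrtr ?ler0n//.
  by field; rewrite gt_eqF.
have n0 : 0 <= jl_scale g m * enorm (X w *m u) by rewrite mulr_ge0 ?enorm_ge0.
apply/andP; split.
  rewrite -(@ler_pXn2r _ 2) ?nnegrE// expr1n -(ler_pM2r mR) mul1r sq.
  apply: (@le_trans _ _ ((1 + g / 2) ^+ 2 * (m%:R * (1 - tau)))); last first.
    by rewrite ler_wpM2l ?sqr_ge0.
  have -> : (1 + g / 2) ^+ 2 * (m%:R * (1 - tau)) =
      m%:R * ((1 + g / 2) * ((2 + g - tau * (2 + g)) / 2)) by field.
  by rewrite tauE ler_peMr ?ltW//; lra.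
rewrite -(@ler_pXn2r _ 2) ?nnegrE//; last by lra.
rewrite -(ler_pM2r mR) sq.
apply: (@le_trans _ _ ((1 + g / 2) ^+ 2 * (m%:R * (1 + tau)))).
  by rewrite ler_wpM2l ?sqr_ge0.
have -> : (1 + g / 2) ^+ 2 * (m%:R * (1 + tau)) =
    (1 + g / 2) * ((2 + g + tau * (2 + g)) / 2) * m%:R by field.
rewrite tauE ler_pM2r// expr2; nra.
Qed.

Lemma probability_bigsetU_le (I : Type) (r : seq I) (F : I -> set T) :
  (forall i, measurable (F i)) ->
  (P (\big[setU/set0]_(i <- r) F i) <= \sum_(i <- r) P (F i))%E.
Proof.
move=> mF; elim: r => [|i r IH]; first by rewrite !big_nil measure0.
rewrite !big_cons; apply: le_trans (measureU2 _ _ _) _ => //.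
  exact: bigsetU_measurable.
exact: leeD.
Qed.

(** Union bound over the k^2 ordered pairs; by linearity each pair amounts to the single vector v i
    - v j. *)
Lemma jl_subgaussian (g delta : R) (k : nat) : 0 < g ->
  k%:R ^+ 2 * (2 * expR (- (m%:R * ((g / (2 + g)) ^+ 2 / 48)))) <= delta ->
  jl_guarantee P (fun w => jl_scale g m *: X w) g k delta.
Proof.
move=> g0 kd v; set q := 2 * _ in kd.
have /choice[A AP] : forall ij : 'I_k * 'I_k, exists A : set T, [/\ measurable A,
    A `<=` [set w | enorm (v ij.1 - v ij.2) <=
      enorm ((jl_scale g m *: X w) *m (v ij.1 - v ij.2)) <=
      (1 + g) * enorm (v ij.1 - v ij.2)] & (P (~` A) <= q%:E)%E].
  by move=> ij; exact: jl_vector.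
pose B := \big[setU/set0]_(ij : 'I_k * 'I_k) ~` A ij.
have mA ij : measurable (~` A ij) by apply: measurableC; have [] := AP ij.
have mB : measurable B by exact: bigsetU_measurable.
exists (~` B); split; first exact: measurableC.
  move=> w wB i j; rewrite -mulmxBr.
  have [_ AS _] := AP (i, j); apply: AS; apply: contrapT => wA; apply: wB.
  by rewrite /B (bigD1 (i, j))//; left.
rewrite probability_setC// EFinB leeB//.
apply: le_trans (probability_bigsetU_le _ _) _ => //.
apply: (@le_trans _ _ (\sum_(ij : 'I_k * 'I_k) q%:E)%E).
  by apply: lee_sum => ij _; have [] := AP ij.
rewrite sumEFin lee_fin sumr_const card_prod card_ord.
by rewrite -mulr_natl natrM -expr2.
Qed.

End JohnsonLindenstrauss.

Section RandomMatrices.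
Variables (R : realType) (disp : measure_display) (T : measurableType disp).
Variables (P : probability T R) (m d : nat) (X : T -> 'M[R]_(m, d)).

Lemma jl_rademacher_gaussian (g delta : R) (k : nat) :
  rademacher_matrix P X \/ gaussian_matrix P X -> (0 < m)%N -> 0 < g ->
  k%:R ^+ 2 * (2 * expR (- (m%:R * ((g / (2 + g)) ^+ 2 / 48)))) <= delta ->
  jl_guarantee P (fun w => jl_scale g m *: X w) g k delta.
Proof.
case=> [[mX iX XE]|[mX iX XE]] m0.
  apply: (jl_subgaussian mX iX (psi := fun s => (expR s + expR (- s)) / 2)) => //.
  - by move=> i j s; apply: mgf_rademacher; [exact: mX | | ]; have [] := XE i j.
  - exact: cosh_le.
  - exact: cosh_ge.
apply: (jl_subgaussian mX iX (psi := fun s => expR (s ^+ 2 / 2))) => //.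
- by move=> i j s; apply: mgf_gaussian; [exact: mX | exact: XE].
- by move=> s; exact: expR_ge1Dx.
Qed.

End RandomMatrices.

(** * Choice of the dimension, with constants depending on [kappa] *)

Section Dimension.
Variable R : realType.
Implicit Types kappa eps delta rho : R.

(* 48 comes from [lower_tail]; [7 * kappa + 2] absorbs the union bound, as
   [ln (2 * n.+1 ^+ 2 / delta) <= 7 + 2 * ln (n / delta)]; the square bounds the
   inverse of the relative deviation [gamma / (2 + gamma)]. *)
Definition jl_const kappa : R :=
  48 * (7 * kappa + 2) * (kappa ^+ 2 + 8 * (1 + 3 * kappa)) ^+ 2.

Section Bounds.
Variables (kappa : R) (n : nat) (eps delta rho : R).
Hypotheses (kappa0 : 0 < kappa) (eps0 : 0 < eps) (delta0 : 0 < delta).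
Hypotheses (rho0 : 0 < rho) (eps_le : eps <= kappa).
Hypothesis ln_n : kappa^-1 <= ln (n%:R / delta).
Hypothesis ln_rho : kappa^-1 <= ln (1 / (eps * rho)).
Let Ln := ln (n%:R / delta).
Let Lr := ln (1 / (eps * rho)).
Let K := Ln * Lr ^+ 2 / eps ^+ 2.

Let kV0 : 0 < kappa^-1. Proof. by rewrite invr_gt0. Qed.

(** At n = 0 the logarithm takes its default value 0, which is below [kappa^-1]. *)
Lemma size_gt0 : (0 < n)%N.
Proof.
rewrite lt0n; apply/negP => /eqP n0; move: ln_n; rewrite n0 mul0r ln0//.
by rewrite leNgt kV0.
Qed.

Let one_le_Ln : 1 <= kappa * Ln.
Proof. by rewrite -(mulfV (lt0r_neq0 kappa0)) ler_pM2l. Qed.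

Let one_le_Lr : 1 <= kappa * Lr.
Proof. by rewrite -(mulfV (lt0r_neq0 kappa0)) ler_pM2l. Qed.

Let one_le_eps : 1 <= kappa / eps.
Proof. by rewrite ler_pdivlMr// mul1r. Qed.

Let ln4E : ln (4 / (eps * rho)) = ln 4 + Lr.
Proof.
rewrite /Lr -lnM ?posrE ?divr_gt0 ?mulr_gt0//.
by rewrite mul1r.
Qed.

Let ln4_gt0 : 0 < ln (4 : R).
Proof. by rewrite ln_gt0// ltr1n. Qed.

Let ln4_le3 : ln (4 : R) <= 3.
Proof. by apply: le_trans (ln_le_sub1 _) _ => //; lra. Qed.

Let Lr0 : 0 < Lr. Proof. exact: lt_le_trans ln_rho. Qed.
Let Ln0 : 0 < Ln. Proof. exact: lt_le_trans ln_n. Qed.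

Lemma jl_gamma_gt0 : 0 < jl_gamma eps rho.
Proof. by rewrite divr_gt0// mulr_gt0// ln4E addr_gt0. Qed.

(** Makes room for rounding the dimension up to an integer. Each of kappa Ln, kappa Lr and kappa /
    eps is at least 1. *)
Lemma dim_scale_ge1 : 1 <= kappa ^+ 5 * K.
Proof.
have -> : kappa ^+ 5 * K = (kappa * Ln) * (kappa * Lr) ^+ 2 * (kappa / eps) ^+ 2.
  by rewrite /K; field; rewrite gt_eqF.
have a1 : 1 <= (kappa * Lr) ^+ 2 by exact: exprn_ege1.
have a2 : 1 <= (kappa / eps) ^+ 2 by exact: exprn_ege1.
by apply: mulr_ege1 => //; exact: mulr_ege1.
Qed.

(** With g = [jl_gamma eps rho] and denominators cleared, 2 + g is to be bounded. The part kappa^2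
    of the constant pays for g; the rest pays for 2, because eps = 4 g (ln 4 + Lr) and ln 4 <= 3
    kappa Lr. *)
Lemma jl_ratio_ge : 1 <= (kappa ^+ 2 + 8 * (1 + 3 * kappa)) * (Lr / eps) *
  (jl_gamma eps rho / (2 + jl_gamma eps rho)).
Proof.
set g := jl_gamma eps rho; have g0 : 0 < g := jl_gamma_gt0.
have gE : g * (4 * (ln 4 + Lr)) = eps.
  by rewrite /g /jl_gamma ln4E divfK// gt_eqF// mulr_gt0// addr_gt0.
rewrite mulrA ler_pdivlMr ?mul1r; last by lra.
have -> : (kappa ^+ 2 + 8 * (1 + 3 * kappa)) * (Lr / eps) * g =
   (kappa / eps) * (kappa * Lr) * g + (8 * Lr + 24 * (kappa * Lr)) * g / eps.
  by field; rewrite gt_eqF.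
have h1 : g <= (kappa / eps) * (kappa * Lr) * g.
  by rewrite ler_peMl ?(ltW g0)//; exact: mulr_ege1.
suff : 2 <= (8 * Lr + 24 * (kappa * Lr)) * g / eps by lra.
rewrite ler_pdivlMr// -gE.
have : ln 4 <= 3 * (kappa * Lr) by have := ln4_le3; have := one_le_Lr; lra.
rewrite -(ler_pM2r g0); lra.
Qed.

Lemma jl_dim_sufficient (m : nat) : delta < 1 -> jl_const kappa * K <= m%:R ->
  n.+1%:R ^+ 2 * (2 * expR (- (m%:R *
    ((jl_gamma eps rho / (2 + jl_gamma eps rho)) ^+ 2 / 48)))) <= delta.
Proof.
move=> delta1 mK; set tau := jl_gamma eps rho / _.
have n0 : 0 < n%:R :> R by rewrite ltr0n size_gt0.
have n1 : 1 <= n%:R :> R by rewrite ler1n size_gt0.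
have nd0 : 0 < n%:R / delta by rewrite divr_gt0.
have tau1 := jl_ratio_ge; rewrite -/tau in tau1.
set a := kappa ^+ 2 + 8 * (1 + 3 * kappa) in tau1.
(* The square of [jl_ratio_ge] absorbs [tau ^+ 2], the square in [jl_const] and the factor (Lr /
   eps)^2 of K. *)
have expo : (7 * kappa + 2) * Ln <= m%:R * (tau ^+ 2 / 48).
  apply: (@le_trans _ _ (jl_const kappa * K * (tau ^+ 2 / 48))); last first.
    by rewrite ler_wpM2r// divr_ge0// sqr_ge0.
  have -> : jl_const kappa * K * (tau ^+ 2 / 48) =
      (7 * kappa + 2) * Ln * (a * (Lr / eps) * tau) ^+ 2.
    by rewrite /jl_const /K -/a; field; rewrite gt_eqF.
  have c0 : 0 <= 7 * kappa + 2 by have := kappa0; lra.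
  apply: ler_peMr; first by rewrite mulr_ge0// ltW.
  exact: exprn_ege1.
(* (n + 1)^2 <= 4 n^2 and delta < 1 give the bound 8 (n / delta)^2, whose logarithm is ln 8 + 2 Ln,
   with ln 8 <= 7 <= 7 kappa Ln. *)
have key : n.+1%:R ^+ 2 * 2 / delta <= expR (m%:R * (tau ^+ 2 / 48)).
  apply: (@le_trans _ _ (8 * (n%:R / delta) ^+ 2)).
    have -> : 8 * (n%:R / delta) ^+ 2 = 8 * n%:R ^+ 2 / delta / delta.
      by field; rewrite gt_eqF.
    rewrite ler_pM2r ?invr_gt0//.
    apply: (@le_trans _ _ (8 * n%:R ^+ 2)).
      have : 0 <= (n%:R - 1) * (6 * n%:R + 2) :> R by rewrite mulr_ge0//; lra.
      by rewrite -natr1 !expr2; lra.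
    by rewrite ler_pdivlMr// ler_piMr ?mulr_ge0 ?sqr_ge0// ltW.
  rewrite -[X in X <= _]lnK; last by rewrite posrE mulr_gt0// exprn_gt0.
  rewrite ler_expR.
  apply: le_trans expo.
  rewrite lnM ?posrE ?exprn_gt0// lnXn// -/Ln mulr2n.
  have : ln (8 : R) <= 7 by apply: le_trans (ln_le_sub1 _) _ => //; lra.
  by have := one_le_Ln; lra.
by rewrite expRN mulrA ler_pdivrMr ?expR_gt0// [leRHS]mulrC -ler_pdivrMr.
Qed.

End Bounds.
End Dimension.

Theorem theorem9 (R : realType) :
  (forall (n d m : nat) (p : 'I_n -> 'cV[R]_d) (eps delta rho : R)
      (disp : measure_display) (T : measurableType disp)
      (P : probability T R) (Pi : T -> 'M[R]_(m, d)),
    0 < eps -> 0 < delta -> 0 < rho ->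
    rho * n%:R <= kde_max p ->
    random_matrix Pi ->
    jl_guarantee P Pi (jl_gamma eps rho) n.+1 delta ->
    with_prob P (1 - delta) [set w | forall x'' : 'cV[R]_m,
      approx_mode (eps / 2) (project (Pi w) p) x'' ->
      approx_mode eps p (mean_shift p (Pi w) x'')]) /\
  (exists c : nat, forall kappa : R, 0 < kappa -> exists C : R,
    forall (n : nat) (eps delta rho : R),
    0 < eps -> 0 < delta -> 0 < rho ->
    eps <= kappa -> kappa^-1 <= ln (n%:R / delta) ->
    kappa^-1 <= ln (1 / (eps * rho)) ->
    exists m : nat,
      m%:R <= C * (ln (n%:R / delta) * ln (1 / (eps * rho)) ^+ 2 / eps ^+ 2) /\
      forall (d : nat) (p : 'I_n -> 'cV[R]_d)
        (disp : measure_display) (T : measurableType disp)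
        (P : probability T R) (X : T -> 'M[R]_(m, d)),
      (0 < d)%N -> rho * n%:R <= kde_max p ->
      rademacher_matrix P X \/ gaussian_matrix P X ->
      let Pi w := jl_scale (jl_gamma eps rho) m *: X w in
      jl_guarantee P Pi (jl_gamma eps rho) n.+1 delta /\
      forall (sub : ('I_n -> 'cV[R]_m) -> 'cV[R]_m)
        (cost : ('I_n -> 'cV[R]_m) -> nat) (t : nat),
      mode_solver (eps / 2) t sub cost ->
      let draws w (ij : 'I_m * 'I_d) := X w ij.1 ij.2 in
      let proc := jl_mode_procedure m eps rho p in
      [/\ forall w, run (draws w) sub proc =
            mean_shift p (Pi w) (sub (project (Pi w) p)),
          forall w, (time (draws w) sub cost proc <= c * (n * d * m) + t)%N
        & with_prob P (1 - delta) [set w |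
            approx_mode eps p (run (draws w) sub proc)]]).
Proof.
split=> [n d m p eps delta rho disp T P Pi eps0 _ rho0 rho_max _|].
  exact: jl_approx_mode.
(* The first summand of C gives a sufficient dimension, the second pays for rounding up. *)
exists 22%N => kappa kappa0; exists (jl_const kappa + kappa ^+ 5).
move=> n eps delta rho eps0 delta0 rho0 eps_le ln_n ln_rho.
set K := ln _ * _ / _.
have n0 : (0 < n)%N := size_gt0 kappa0 ln_n.
have K1 : 1 <= kappa ^+ 5 * K by exact: dim_scale_ge1.
have K0 : 0 <= K.
  by rewrite -(pmulr_rge0 _ (exprn_gt0 5 kappa0)) (le_trans ler01 K1).
have D0 : 0 <= jl_const kappa * K.
  rewrite mulr_ge0// mulr_ge0 ?sqr_ge0//; lra.
exists (Num.truncn (jl_const kappa * K)).+1; split.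
  rewrite -natr1 mulrDl lerD//.
  by have /andP[] := truncn_itv D0.
set m := _.+1 => d p disp T P X d0 rho_max XP Pi.
have jl : jl_guarantee P Pi (jl_gamma eps rho) n.+1 delta.
  (* For delta >= 1 the required probability is at most 0 and the empty event serves. *)
  have [delta1|delta1] := lerP 1 delta.
    move=> v; exists set0; split => //.
    by rewrite measure0 lee_fin subr_le0.
  apply: jl_rademacher_gaussian => //.
    exact: jl_gamma_gt0 ln_rho.
  apply: jl_dim_sufficient ln_n ln_rho _ _ _ => //.
  by have /andP[_ /ltW] := truncn_itv D0.
split=> // sub cost t solver draws proc.
have runE w : run (draws w) sub proc = mean_shift p (Pi w) (sub (project (Pi w) p)).
  rewrite /proc run_jl_mode_procedure.
  suff -> : \matrix_(i, j) draws w (i, j) = X w by [].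
  by apply/matrixP => i j; rewrite mxE.
split=> // [w|].
  by apply: time_jl_mode_procedure => // q; have [] := solver q.
apply: with_probS (jl_approx_mode eps0 rho0 rho_max jl) => w modew.
by have := modew _ (solver (project (Pi w) p)).1; rewrite -runE.
Qed.
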